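(* Let $(M,g_{ij})$ be a Riemannian manifold of dimension $n$, let $h=(h_{\alpha\beta})$ be a Riemannian metric on $\mathbb{R}^m_+$ with inverse $(h^{\alpha\beta})$, let $\tau\in\mathbb{R}^m_+$, let $\Omega_{0\tau}=\{t\in\mathbb{R}^m: 0\le t^\alpha\le\tau^\alpha,\ \alpha=1,\dots,m\}$, and consider the multitime optimal control problem $$\max_{u(\cdot)}E(u(\cdot)),\qquad E(u(\cdot))=-\frac12\int_{\Omega_{0\tau}}h^{\alpha\beta}(t)\,g_{ij}(x(t))\,u^i_\alpha(t)\,u^j_\beta(t)\,dt,$$ subject to $$\frac{\partial x^i}{\partial t^\alpha}(t)=u^i_\alpha(t),\quad i=1,\dots,n,\ \alpha=1,\dots,m,\qquad u\in\mathcal{U},\ t\in\Omega_{0\tau},\qquad x(0)=x_0,\ x(\tau)=x_1,$$ where $\mathcal{U}$ is the set of controls $u=(u_\alpha)=(u^i_\alpha):\Omega_{0\tau}\to\mathbb{R}^{mn}$, consisting of $C^1$ linearly independent control vectors $u_1,\dots,u_m$, that satisfy the complete integrability conditions $\frac{\partial u^i_\alpha}{\partial t^\beta}=\frac{\partial u^i_\beta}{\partial t^\alpha}$ for all $i,\alpha,\beta$. Then a $C^2$ solution $x(\cdot)$ of this optimal control problem is a harmonic map.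
   Context: Summation over repeated indices is used: Latin indices run from $1$ to $n$, Greek indices from $1$ to $m$; $dt=dt^1\wedge\dots\wedge dt^m$. Everything is written in local coordinates $(x^1,\dots,x^n)$ on $M$. A $C^2$ solution of the system $\partial x^i/\partial t^\alpha=u^i_\alpha$ is a map ($m$-sheet) $x^i=x^i(t^1,\dots,t^m)$; the controls may possibly also be fixed on the boundary $\partial\Omega_{0\tau}$. The quantity $\frac12h^{\alpha\beta}(t)g_{ij}(x(t))u^i_\alpha(t)u^j_\beta(t)$ is the energy density of the $m$-sheet $x(t)$, and $E$ is called the energy functional (elastic deformation energy). Harmonic maps are understood variationally, as the maps satisfying the multitime Euler–Lagrange equations $\frac{\partial L}{\partial x^i}-D_\alpha\left(\frac{\partial L}{\partial x^i_\alpha}\right)=0$ for $L=-\frac12h^{\alpha\beta}(t)g_{ij}(x)x^i_\alpha x^j_\beta$, where $x^i_\alpha=\partial x^i/\partial t^\alpha=u^i_\alpha$ and $D_\alpha$ is the total derivative operator with respect to $t^\alpha$. *)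

(* Defs.v *)
From HB Require Import structures.
From mathcomp Require Import all_boot all_order all_algebra.
From mathcomp Require Import all_classical all_reals all_analysis.
Set Implicit Arguments.
Unset Strict Implicit.
Unset Printing Implicit Defensive.
Import Order.TTheory GRing.Theory Num.Theory.
Import numFieldNormedType.Exports.
Local Open Scope classical_set_scope.
Local Open Scope ring_scope.

(* Points of R^k are row vectors.  Functions on a subset D of R^k are total
   functions of which only the values on D are ever used. *)

Section Calculus.
Context {R : realType} {k : nat}.
Implicit Types (D : set 'rV[R]_k) (f : 'rV[R]_k -> R) (a : 'I_k) (t : 'rV[R]_k).

Definition basis_vec a : 'rV[R]_k := delta_mx 0 a.

Definition diff_quot f a t (s : R) : R := s^-1 * (f (t + s *: basis_vec a) - f t).

(* The increments s are restricted to those for which t + s e_a stays in D: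
   this is the usual partial derivative at interior points of D, and the
   one-sided one on the faces of a box or of an orthant. *)
Definition incr D a t : set_system R :=
  within [set s | D (t + s *: basis_vec a)] 0^'.

Definition pderivable D a f t : Prop := cvg (diff_quot f a t @ incr D a t).

Definition pderiv D a f t : R := lim (diff_quot f a t @ incr D a t).

(* f is of class C^p on D. *)
Fixpoint class_C (p : nat) D f : Prop :=
  if p is q.+1 then
    {within D, continuous f} /\
    forall a, (forall t, D t -> pderivable D a f t) /\
              class_C q D (pderiv D a f)
  else {within D, continuous f}.

Definition riemannian_metric D (g : 'rV[R]_k -> 'M[R]_k) : Prop :=
  [/\ forall (p : nat) i j, class_C p D (fun t => g t i j),
      forall t, D t -> (g t)^T = g t &
      forall t, D t -> forall v : 'rV[R]_k, v != 0 -> 0 < (v *m g t *m v^T) 0 0].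

Definition orthant : set 'rV[R]_k := [set t | forall a, 0 <= t 0 a].

Definition box (tau : 'rV[R]_k) : set 'rV[R]_k :=
  [set t | forall a, 0 <= t 0 a <= tau 0 a].

Definition box_boundary (tau : 'rV[R]_k) : set 'rV[R]_k :=
  [set t | box tau t /\ exists a, t 0 a = 0 \/ t 0 a = tau 0 a].

End Calculus.

(* The multiple integral of f over [box tau], as an iterated integral; by Fubini
   this is the Lebesgue integral over the box for every continuous f. *)
Fixpoint box_integral {R : realType} {k : nat} :
    'rV[R]_k -> ('rV[R]_k -> R) -> R :=
  match k return 'rV[R]_k -> ('rV[R]_k -> R) -> R with
  | 0 => fun _ f => f 0
  | l.+1 => fun tau f =>
      Rintegral lebesgue_measure `[0, tau 0 ord0]
        (fun s : R => box_integral (\row_(j < l) tau 0 (lift ord0 j))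
           (fun t : 'rV[R]_l => f (row_mx (const_mx s : 'rV[R]_1) t)))
  end.

(* The manifold is given by the open domain M of R^n of its coordinates, so that
   a sheet is a map from the box to M. *)
Section Sheets.
Context {R : realType} {m n : nat}.

(* An array (v^i_alpha) is the m x n matrix v with entries v alpha i; its rows
   are the vectors v_1, ..., v_m of R^n. *)
Implicit Types (v : 'M[R]_(m, n)) (t tau : 'rV[R]_m) (x : 'rV[R]_m -> 'rV[R]_n)
  (u : 'rV[R]_m -> 'M[R]_(m, n)) (M : set 'rV[R]_n)
  (L : 'rV[R]_m -> 'rV[R]_n -> 'M[R]_(m, n) -> R)
  (h : 'rV[R]_m -> 'M[R]_m) (g : 'rV[R]_n -> 'M[R]_n).

Definition hg_form h g t (y : 'rV[R]_n) v : R :=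
  \sum_(a < m) \sum_(b < m) \sum_(i < n) \sum_(j < n)
    invmx (h t) a b * g y i j * v a i * v b j.

Definition energy h g tau x u : R :=
  - (1 / 2) * box_integral tau (fun t => hg_form h g t (x t) (u t)).

Definition lagrangian h g t (y : 'rV[R]_n) v : R := - (1 / 2) * hg_form h g t y v.

(* Linear independence of u_1, ..., u_m is pointwise, at every t of the box. *)
Definition control_set tau u : Prop :=
  [/\ forall a i, class_C 1 (box tau) (fun t => u t a i),
      forall t, box tau t -> row_free (u t) &
      forall t, box tau t -> forall a b i,
        pderiv (box tau) b (fun s => u s a i) t =
        pderiv (box tau) a (fun s => u s b i) t].

Definition sheet_of M tau u x : Prop :=
  forall t, box tau t -> M (x t) /\
    forall a i, pderivable (box tau) a (fun s => x s 0 i) t /\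
                pderiv (box tau) a (fun s => x s 0 i) t = u t a i.

(* [ub] is the optional prescription of the controls on the boundary of the
   box; [None] means that they are free there. *)
Definition admissible M tau (x0 x1 : 'rV[R]_n)
    (ub : option ('rV[R]_m -> 'M[R]_(m, n))) x u : Prop :=
  [/\ control_set tau u, sheet_of M tau u x, x 0 = x0, x tau = x1 &
      if ub is Some w then forall t, box_boundary tau t -> u t = w t else True].

Definition optimal M h g tau (x0 x1 : 'rV[R]_n) ub x u : Prop :=
  admissible M tau x0 x1 ub x u /\
  forall y w, admissible M tau x0 x1 ub y w ->
    energy h g tau y w <= energy h g tau x u.

Definition velocity tau x t : 'M[R]_(m, n) :=
  \matrix_(a, i) pderiv (box tau) a (fun s => x s 0 i) t.

Definition dL_dx L (i : 'I_n) t (y : 'rV[R]_n) v : R :=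
  derive1 (fun s : R => L t (y + s *: basis_vec i) v) 0.

Definition dL_dv L (a : 'I_m) (i : 'I_n) t (y : 'rV[R]_n) v : R :=
  derive1 (fun s : R => L t y (v + s *: delta_mx a i)) 0.

(* The total derivative D_a of a function F (t, x, v) along the sheet x. *)
Definition total_deriv tau x (a : 'I_m)
    (F : 'rV[R]_m -> 'rV[R]_n -> 'M[R]_(m, n) -> R) t : R :=
  pderiv (box tau) a (fun s => F s (x s) (velocity tau x s)) t.

(* The equations dL/dx^i - D_a (dL/dx^i_a) = 0, with summation over a. *)
Definition euler_lagrange tau L x : Prop :=
  forall t, box tau t -> forall i : 'I_n,
    dL_dx L i t (x t) (velocity tau x t)
    - \sum_(a < m) total_deriv tau x a (dL_dv L a i) t = 0.

Definition class_C2_sheet tau x : Prop :=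
  forall i, class_C 2 (box tau) (fun t => x t 0 i).

Definition harmonic_map M h g tau x : Prop :=
  [/\ class_C2_sheet tau x, forall t, box tau t -> M (x t) &
      euler_lagrange tau (lagrangian h g) x].

End Sheets.

(* Main.v *)
Require Import Defs.
From HB Require Import structures.
From mathcomp Require Import all_boot all_order all_algebra.
From mathcomp Require Import all_classical all_reals all_analysis.
From mathcomp Require Import ring lra.
Import Order.TTheory GRing.Theory Num.Theory.
Import numFieldNormedType.Exports.
Local Open Scope classical_set_scope.
Local Open Scope ring_scope.

(* A sheet x with values in an open set of R^n can be moved to x + s eta e_k, where
   eta is a C^2 bump supported in the interior of the box.  For small s this is again
   admissible: the image stays in M and the velocities stay linearly independent by
   compactness of the box, the integrability conditions hold because the second
   derivatives of eta commute, and nothing changes on the boundary.  Maximality at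
   s = 0 makes the derivative in s of the energy vanish, and integration by parts
   turns this into: the integral of eta times the Euler-Lagrange expression is 0 for
   every such eta.  So that expression vanishes in the interior, and on the faces of
   the box by continuity. *)

(** * Partial derivatives *)

(** Regularity is given through partial derivatives only, one-sided on the faces, whereas
    differentiating along the sheet needs total differentiability; mean value estimates along
    coordinate edges supply it. Derivatives are handled as a relation [is_pder] carrying its value,
    because [pderiv] is a chosen limit, unique only where the increments form a proper filter. The
    energy is never differentiated in s. A first-order expansion in s, uniform over the box, is
    integrated as an inequality, and small s of both signs force the integral of the linear
    coefficient to be 0. The same expansion, read at one point and with other data, computes the
    derivatives of the Lagrangian, so that the weak equation and the Euler-Lagrange expression come
    from a single computation. The gradient of the bump enters the controls, which must be C^1; a
    cubed positive part of a quadratic polynomial is smooth enough for this, and its Hessian is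
    explicit. *)

Definition is_pder {R : realType} {k : nat} (D : set 'rV[R]_k) (a : 'I_k)
    (f : 'rV[R]_k -> R) (t : 'rV[R]_k) (l : R) : Prop :=
  diff_quot f a t @ incr D a t --> l.

Section PartialDerivatives.
Set Implicit Arguments.
Unset Strict Implicit.
Context {R : realType} {k : nat}.
Implicit Types (D : set 'rV[R]_k) (f g : 'rV[R]_k -> R) (a : 'I_k)
  (t : 'rV[R]_k) (l : R).

Lemma near_cvg T (F : set_system T) {FF : Filter F} (f g : T -> R) (l : R) :
  f @ F --> l -> (\forall s \near F, f s = g s) -> g @ F --> l.
Proof. by move=> fl fg; apply: cvg_trans fl; exact: near_eq_cvg. Qed.

Lemma near_incr D a t (P : R -> Prop) :
  (forall s, s != 0 -> D (t + s *: basis_vec a) -> P s) ->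
  \forall s \near incr D a t, P s.
Proof.
move=> DP; rewrite /incr near_withinE /dnbhs near_withinE.
by near=> s => s0 Ds; exact: DP.
Unshelve. all: by end_near. Qed.

Lemma incr_within0 D a t : incr D a t --> (0 : R).
Proof.
move=> P P0; rewrite /incr /=.
apply: filterS (nbhs_dnbhs P0) => s Ps _; exact: Ps.
Qed.

Lemma eq_is_pder D a f g t l : D t -> (forall s, D s -> f s = g s) ->
  is_pder D a f t l -> is_pder D a g t l.
Proof.
move=> Dt fg fl; apply: (near_cvg fl).
by apply: near_incr => s _ Ds; rewrite /diff_quot !fg.
Qed.

Lemma is_pder_eq D a f t l l' : is_pder D a f t l -> l = l' -> is_pder D a f t l'.
Proof. by move=> ? <-. Qed.

(** Multiplying the quotient back by [s], which tends to 0, recovers continuity, but along one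
    coordinate line only. *)
Lemma is_pder_line D a f t l : is_pder D a f t l ->
  f (t + s *: basis_vec a) @[s --> incr D a t] --> f t.
Proof.
move=> fl.
have : f t + s * diff_quot f a t s @[s --> incr D a t] --> f t + 0 * l.
  apply: cvgD; first exact: cvg_cst.
  by apply: cvgM fl; exact: incr_within0.
rewrite mul0r addr0 => /near_cvg; apply.
by apply: near_incr => s s0 _; rewrite /diff_quot mulrA divff// mul1r addrC subrK.
Qed.

Lemma is_pder_cst D a t c : is_pder D a (fun=> c) t 0.
Proof.
rewrite /is_pder (_ : diff_quot _ _ _ = cst 0); first exact: cvg_cst.
by apply/funext => s; rewrite /diff_quot subrr mulr0.
Qed.

Lemma is_pderD D a f g t l l' : is_pder D a f t l -> is_pder D a g t l' ->
  is_pder D a (fun s => f s + g s) t (l + l').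
Proof.
move=> fl gl'; apply: (near_cvg (cvgD fl gl')).
by apply: nearW => s; rewrite /diff_quot !fctE; ring.
Qed.

Lemma is_pderM D a f g t l l' : is_pder D a f t l -> is_pder D a g t l' ->
  is_pder D a (fun s => f s * g s) t (l * g t + f t * l').
Proof.
move=> fl gl'.
apply: (near_cvg (cvgD (cvgM fl (is_pder_line gl')) (cvgM (cvg_cst (f t)) gl'))).
apply: nearW => s.
by rewrite /diff_quot !fctE /=; ring.
Qed.

Lemma is_pder_sum D a I (r : seq I) (P : pred I) (F : I -> 'rV[R]_k -> R) t L :
  (forall i, P i -> is_pder D a (F i) t (L i)) ->
  is_pder D a (fun s => \sum_(i <- r | P i) F i s) t (\sum_(i <- r | P i) L i).
Proof.
move=> FL; elim: r => [|i r IH].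
  rewrite big_nil (_ : (fun _ => _) = fun=> 0); first exact: is_pder_cst.
  by apply/funext => s; rewrite big_nil.
rewrite big_cons; under [X in is_pder _ _ X]funext do rewrite big_cons.
by case: ifPn => // Pi; apply: is_pderD => //; exact: FL.
Qed.

Lemma is_pderV D a f t l : f t != 0 -> is_pder D a f t l ->
  is_pder D a (fun s => (f s)^-1) t (- l / (f t * f t)).
Proof.
move=> ft0 fl.
have fne : \forall s \near incr D a t, f (t + s *: basis_vec a) != 0.
  have /cvgrPdist_lt /(_ `|f t|) := is_pder_line fl.
  rewrite normr_gt0 => /(_ ft0); apply: filterS => s.
  by apply: contraTN => /eqP ->; rewrite subr0 ltxx.
have : (- diff_quot f a t s) / (f t * f (t + s *: basis_vec a))
    @[s --> incr D a t] --> - l / (f t * f t).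
  apply: cvgM; first exact: cvgN.
  apply: cvgV; first by rewrite mulf_neq0.
  by apply: cvgM; [exact: cvg_cst|exact: is_pder_line fl].
move=> /near_cvg; apply.
apply: filterS fne => s fs0; rewrite /diff_quot.
have [->|s0] := eqVneq s 0; first by rewrite invr0 !mul0r oppr0 mul0r.
by field; rewrite s0 ft0 fs0.
Qed.

(** The derivative 2 max(0, x) of max(0, x)^2 is 2-Lipschitz, whence a first-order remainder of at
    most (b - c)^2; the proof goes by the signs of [b] and [c]. *)
Lemma pos_sqr_taylor (b c : R) :
  `|2 * Num.max 0 c * (b - c) - (Num.max 0 b ^+ 2 - Num.max 0 c ^+ 2)| <=
  `|(b - c) * (b - c)|.
Proof.
have -> : `|(b - c) * (b - c)| = (b - c) ^+ 2 by rewrite ger0_norm -expr2// sqr_ge0.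
rewrite ler_norml; have b2 := sqr_ge0 b; have c2 := sqr_ge0 c; have bc2 := sqr_ge0 (b - c).
case: (leP 0 b) => b0; case: (leP 0 c) => c0; apply/andP.
- by split; nra.
- have : b * c <= 0 by rewrite mulr_ge0_le0// ltW.
  by split; nra.
- have : b * c <= 0 by rewrite mulr_le0_ge0// ltW.
  by split; nra.
- by split; nra.
Qed.

(* By [pos_sqr_taylor] the difference quotient of the square differs from
   [2 max(0, f t)] times that of [f] by at most the latter times
   [f (t + s e) - f t], which tends to 0. *)
Lemma is_pder_pos2 D a f t l : is_pder D a f t l ->
  is_pder D a (fun s => Num.max 0 (f s) ^+ 2) t (2 * Num.max 0 (f t) * l).
Proof.
move=> fl; apply/cvgrPdist_le => e e0.
have B : 2 * Num.max 0 (f t) * diff_quot f a t s @[s --> incr D a t] -->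
    2 * Num.max 0 (f t) * l by apply: cvgM fl; exact: cvg_cst.
have C : diff_quot f a t s * (f (t + s *: basis_vec a) - f t)
    @[s --> incr D a t] --> l * (f t - f t).
  by apply: (cvgM fl (cvgB (is_pder_line fl) (cvg_cst _))).
rewrite subrr mulr0 in C.
have e20 : 0 < e / 2 by rewrite divr_gt0.
move/cvgrPdist_le : B => /(_ _ e20) B; move/cvgrPdist_le : C => /(_ _ e20) C.
near=> s.
have [b1 c1] : `|2 * Num.max 0 (f t) * l - 2 * Num.max 0 (f t) * diff_quot f a t s| <= e / 2
   /\ `|0 - diff_quot f a t s * (f (t + s *: basis_vec a) - f t)| <= e / 2.
  by split; near: s.
rewrite (_ : _ - _ = (2 * Num.max 0 (f t) * l - 2 * Num.max 0 (f t) * diff_quot f a t s)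
  + (2 * Num.max 0 (f t) * diff_quot f a t s - diff_quot (fun s => Num.max 0 (f s) ^+ 2) a t s)); last by ring.
rewrite (le_trans (ler_normD _ _))// [leRHS]splitr lerD//.
apply: le_trans c1; rewrite sub0r normrN /diff_quot.
set b := f (_ + _); set c := f t.
rewrite (_ : _ - _ = s^-1 * (2 * Num.max 0 c * (b - c) - (Num.max 0 b ^+ 2 - Num.max 0 c ^+ 2))); last by ring.
rewrite -[s^-1 * (b - c) * _]mulrA [leLHS]normrM [leRHS]normrM ler_wpM2l//.
exact: pos_sqr_taylor.
Unshelve. all: by end_near. Qed.

End PartialDerivatives.

(** * Mean value estimate along a coordinate segment *)

Section MeanValue.
Set Implicit Arguments.
Unset Strict Implicit.
Context {R : realType} {k : nat}.
Implicit Types (D : set 'rV[R]_k) (f : 'rV[R]_k -> R) (a : 'I_k)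
  (t : 'rV[R]_k) (l : R).

Lemma is_pder_line0 D a f t l : is_pder D a f t l ->
  forall e, 0 < e -> \forall s \near (0 : R), D (t + s *: basis_vec a) ->
    `|f t - f (t + s *: basis_vec a)| < e.
Proof.
move=> /is_pder_line/cvgrPdist_lt fl e e0; have := fl e e0.
rewrite /incr near_withinE /dnbhs near_withinE; apply: filterS => s.
have [-> _ _|s0 H] := eqVneq s 0; last exact: H.
by rewrite scale0r addr0 subrr normr0.
Qed.

(** Bridge to [is_derive], the form used by the mean value theorem and the fundamental theorem of
    calculus. *)
Lemma is_derive_of_cvg (f : R -> R) (x d : R) :
  h^-1 * (f (h + x) - f x) @[h --> 0^'] --> d -> is_derive x 1 f d.
Proof.
have -> : (fun h => h^-1 * (f (h + x) - f x)) =
    (fun h => h^-1 *: ((f \o shift x) (h *: (1 : R)) - f x)).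
  by apply/funext => h; rewrite /= /shift /= [h *: 1]mulr1.
by move=> H; split; [apply/cvg_ex; exists d|exact: cvg_lim H].
Qed.

(** The one-variable mean value theorem is applied on [0, 1] to [phi], whose derivative is [z] times
    [df]. Measuring [df] against a constant [c] gives directly the first-order remainder needed by
    the later uniform estimates. *)
Lemma pder_mvt D a f (df : 'rV[R]_k -> R) t (z c e : R) :
  (forall th : R, 0 <= th <= 1 -> D (t + (th * z) *: basis_vec a)) ->
  (forall s, D s -> is_pder D a f s (df s)) ->
  (forall th : R, 0 <= th <= 1 -> `|df (t + (th * z) *: basis_vec a) - c| <= e) ->
  `|f (t + z *: basis_vec a) - f t - z * c| <= e * `|z|.
Proof.
have [-> _ _ _|z0 segD fdf dfc] := eqVneq z 0.
  by rewrite scale0r addr0 subrr mul0r subrr normr0 mulr0.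
pose phi th := f (t + (th * z) *: basis_vec a).
have shiftE (th h : R) : t + ((h + th) * z) *: basis_vec a =
    t + (th * z) *: basis_vec a + (h * z) *: basis_vec a.
  by rewrite -addrA -scalerDl -mulrDl [th + h]addrC.
have dphi (th : R) : th \in `]0, 1[ ->
    is_derive th 1 phi (z * df (t + (th * z) *: basis_vec a)).
  rewrite in_itv/= => /andP[th0 th1]; apply: is_derive_of_cvg.
  set q := t + (th * z) *: basis_vec a.
  have Dq : D q by apply: segD; rewrite !ltW.
  have hz : h * z @[h --> 0^'] --> incr D a q.
    move=> P HP; have {}HP : \forall s \near incr D a q, P s by exact: HP.
    rewrite /incr near_withinE /dnbhs near_withinE in HP.
    have : h * z @[h --> (0 : R)] --> 0 * z.
      by apply: cvgM; [exact: cvg_id|exact: cvg_cst].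
    rewrite mul0r => /(_ _ HP) /= HP'.
    suff : \forall h \near (0 : R)^', P (h * z) by [].
    rewrite /dnbhs near_withinE; near=> h => h0.
    have : h * z != 0 -> D (q + (h * z) *: basis_vec a) -> P (h * z) by near: h; exact: HP'.
    apply; first by rewrite mulf_neq0.
    (* Such [h] keep [h + th] in [0, 1], so the moved point is still on the segment, hence in
       [D]. *)
    have : `|h| < Num.min th (1 - th).
      near: h; apply/nbhs_ballP; exists (Num.min th (1 - th)) => /=.
        by rewrite lt_min; apply/andP; split; lra.
      by move=> h; rewrite /ball /= sub0r normrN.
    rewrite lt_min !ltr_norml => /andP[/andP[h1 _] /andP[_ h2]].
    by rewrite /q -shiftE; apply: segD; apply/andP; split; lra.
  apply: (near_cvg (cvgM (cvg_cst z) (cvg_comp _ _ hz (fdf q Dq)))).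
  rewrite /dnbhs near_withinE; apply: nearW => h h0.
  rewrite !fctE /= /diff_quot /phi shiftE -/q invfM; field; rewrite z0 andbT; exact: h0.
have cphi : {within `[0, 1], continuous phi}.
  apply/subspace_continuousP => th /=; rewrite in_itv /= => thI.
  set q := t + (th * z) *: basis_vec a.
  apply/cvgrPdist_lt => eps eps0.
  have := is_pder_line0 (fdf q (segD _ thI)) eps0 => H.
  have : (th' - th) * z @[th' --> th] --> (th - th) * z.
    by apply: cvgM; [apply: cvgB; [exact: cvg_id|exact: cvg_cst]|exact: cvg_cst].
  rewrite subrr mul0r => /(_ _ H) /= {}H.
  rewrite near_withinE; near=> th' => th'I.
  have : D (q + ((th' - th) * z) *: basis_vec a) ->
    `|f q - f (q + ((th' - th) * z) *: basis_vec a)| < eps by near: th'.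
  rewrite /q -shiftE subrK; apply; apply: segD.
  by move: th'I; rewrite /= in_itv.
have [th] := MVT (ltr01) dphi cphi.
rewrite in_itv /= => /andP[th0 th1].
rewrite /phi mul1r mul0r scale0r addr0 => ->.
rewrite subr0 mulr1 -mulrBr normrM mulrC ler_wpM2r//.
by apply: dfc; rewrite !ltW.
Unshelve. all: by end_near. Qed.

End MeanValue.

Lemma cvg_mx {R : realType} {p q : nat} {T : Type} (F : set_system T)
    {FF : Filter F} (x : T -> 'M[R]_(p, q)) (l : 'M[R]_(p, q)) :
  (forall i j, x s i j @[s --> F] --> l i j) -> x @ F --> l.
Proof.
move=> xl; apply/cvg_ballP => e e0.
have : \forall s \near F, forall i j, ball (l i j) e (x s i j).
  apply: filter_forall => i; apply: filter_forall => j.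
  by have /cvg_ballP /(_ e e0) := xl i j.
by apply: filterS => s H; split.
Qed.

Lemma continuous_mx {R : realType} {p q : nat} {T : topologicalType}
    (x : T -> 'M[R]_(p, q)) :
  (forall i j, continuous (fun s => x s i j)) -> continuous x.
Proof. by move=> cx t; apply: cvg_mx => i j; exact: cx. Qed.

Lemma within_continuous_open_comp {R : realType} {n : nat} {T : topologicalType}
    (B : set T) (M : set 'rV[R]_n) (G : 'rV[R]_n -> R) (x : T -> 'rV[R]_n) :
  open M -> {within M, continuous G} -> (forall t, B t -> M (x t)) ->
  (forall i, {within B, continuous (fun t => x t 0 i)}) ->
  {within B, continuous (fun t => G (x t))}.
Proof.
move=> oM cG BM cx.
apply: (@within_continuous_comp _ _ _ B x G).
  move=> _ /[!inE] -[t Bt <-].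
  by move: cG; rewrite continuous_open_subspace// => /(_ (x t)); apply; rewrite inE; exact: BM.
by apply: continuous_mx => i j; rewrite ord1; exact: cx.
Qed.

(** * Total differentiability of C^1 functions on an open set, and the chain rule *)

Section Taylor.
Set Implicit Arguments.
Unset Strict Implicit.
Context {R : realType} {n : nat} (M : set 'rV[R]_n) (oM : open M).

Lemma class_C1_is_pder (G : 'rV[R]_n -> R) i y : class_C 1 M G -> M y ->
  is_pder M i G y (pderiv M i G y).
Proof. by move=> [_ /(_ i)[H _]] My; exact: H. Qed.

(* The segment from [y] to [y'] is replaced by a path changing one coordinate at
   a time, and the mean value theorem is applied to each of its edges. *)
Lemma class_C1_taylor (G : 'rV[R]_n -> R) y e : class_C 1 M G -> M y -> 0 < e ->
  \forall y' \near y,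
    `|G y' - G y - \sum_i (y' 0 i - y 0 i) * pderiv M i G y|
      <= e * \sum_i `|y' 0 i - y 0 i|.
Proof.
move=> CG My e0.
have : \forall y' \near y, M y' /\
    forall i, `|pderiv M i G y' - pderiv M i G y| <= e.
  near=> y'; split; first by near: y'; exact: open_nbhs_nbhs.
  near: y'; apply: filter_forall => i.
  have [_ /(_ i)[_]] := CG; rewrite /= continuous_open_subspace// => /(_ y).
  rewrite inE => /(_ My)/cvgrPdist_le/(_ e e0).
  by apply: filterS => y'; rewrite distrC.
move=> /nbhs_ballP[r /= r0 H].
apply/nbhs_ballP; exists r => //= y' [_ yy'].
pose p (j : nat) : 'rV[R]_n := \row_i (if (i < j)%N then y' 0 i else y 0 i).
have p0 : p 0%N = y by apply/rowP => i; rewrite mxE.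
have pn : p n = y' by apply/rowP => i; rewrite mxE ltn_ord.
have pS (j : 'I_n) : p j.+1 = p j + (y' 0 j - y 0 j) *: basis_vec j.
  apply/rowP => i; rewrite !mxE eqxx /=.
  have [->|ij] := eqVneq i j; first by rewrite ltnSn ltnn mulr1 addrC subrK.
  by rewrite mulr0 addr0 ltnS leq_eqVlt (inj_eq val_inj) (negbTE ij).
(* Balls of row vectors are cubes, so a point whose coordinates each lie between those of [y] and
   [y'] stays in the ball. *)
have seg (j : 'I_n) th : 0 <= th <= 1 ->
    ball y r (p j + (th * (y' 0 j - y 0 j)) *: basis_vec j).
  move=> /andP[th0 th1]; split => // i0 i; rewrite ord1 !mxE eqxx /=.
  have := yy' 0 i; rewrite /ball /=.
  have [->|ij] := eqVneq i j.
    rewrite ltnn mulr1 opprD addrA subrr add0r normrN normrM ger0_norm// distrC.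
    by apply: le_lt_trans; rewrite ler_piMl.
  by rewrite mulr0 addr0; case: ifP => // _; rewrite subrr normr0.
have -> : G y' - G y = \sum_(j < n) (G (p j.+1) - G (p j)).
  by rewrite -(big_mkord xpredT (fun j => G (p j.+1) - G (p j))) telescope_sumr// pn p0.
rewrite -sumrB mulr_sumr (le_trans (ler_norm_sum _ _ _))// ler_sum// => j _.
rewrite pS; apply: (@pder_mvt _ _ M j G (pderiv M j G)).
- by move=> th th01; have [] := H _ (seg j th th01).
- by move=> s Ms; exact: class_C1_is_pder.
- by move=> th th01; have [_] := H _ (seg j th th01); apply.
Unshelve. all: by end_near. Qed.

(** Divided by [s], the Taylor remainder of [G] is at most a small constant times the sum of the
    absolute difference quotients of the coordinates, and that sum converges. *)
Lemma is_pder_chain k (D : set 'rV[R]_k) a (G : 'rV[R]_n -> R)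
    (x : 'rV[R]_k -> 'rV[R]_n) t (d : 'I_n -> R) : class_C 1 M G -> M (x t) ->
  (forall i, is_pder D a (fun s => x s 0 i) t (d i)) ->
  is_pder D a (fun s => G (x s)) t (\sum_i d i * pderiv M i G (x t)).
Proof.
move=> CG Mxt xd; apply/cvgrPdist_le => e e0.
pose c i := pderiv M i G (x t).
have sumd : \sum_i diff_quot (fun s => x s 0 i) a t s * c i
    @[s --> incr D a t] --> \sum_i d i * c i.
  by apply: cvg_big => [|i _]; [exact: add_continuous|apply: cvgM (cvg_cst _); exact: xd].
have sumn : \sum_i `|diff_quot (fun s => x s 0 i) a t s|
    @[s --> incr D a t] --> \sum_i `|d i|.
  by apply: cvg_big => [|i _]; [exact: add_continuous|apply: cvg_norm; exact: xd].
(* [K] eventually exceeds the sum of the absolute difference quotients, so the Taylor constant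
   [e / 2 / K] costs at most [e / 2]. *)
pose K := \sum_i `|d i| + 1.
have K0 : 0 < K by rewrite ltr_pwDr// sumr_ge0.
have e20 : 0 < e / 2 by rewrite divr_gt0.
have xcvg : x (t + s *: basis_vec a) @[s --> incr D a t] --> x t.
  by apply: cvg_mx => i j; rewrite ord1; exact: is_pder_line (xd j).
have eK : 0 < e / 2 / K by rewrite divr_gt0.
have tay := xcvg _ (class_C1_taylor CG Mxt eK).
move/cvgrPdist_le : sumd => /(_ _ e20) sumd.
move/cvgrPdist_lt : sumn => /(_ _ ltr01) sumn.
near=> s.
have h1 : `|\sum_i d i * c i - \sum_i diff_quot (fun s => x s 0 i) a t s * c i| <= e / 2.
  by near: s.
have h2 : `|\sum_i `|d i| - \sum_i `|diff_quot (fun s => x s 0 i) a t s| | < 1.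
  by near: s.
have h3 : `|G (x (t + s *: basis_vec a)) - G (x t) -
     \sum_i (x (t + s *: basis_vec a) 0 i - x t 0 i) * c i|
      <= e / 2 / K * \sum_i `|x (t + s *: basis_vec a) 0 i - x t 0 i|.
  by near: s.
rewrite -(subrKA (\sum_i diff_quot (fun s => x s 0 i) a t s * c i)).
rewrite (le_trans (ler_normD _ _))// [leRHS]splitr lerD//.
rewrite distrC /diff_quot.
have -> : \sum_i s^-1 * (x (t + s *: basis_vec a) 0 i - x t 0 i) * c i =
    s^-1 * \sum_i (x (t + s *: basis_vec a) 0 i - x t 0 i) * c i.
  by rewrite mulr_sumr; apply: eq_bigr => i _; rewrite mulrA.
rewrite -mulrBr normrM.
apply: le_trans (ler_wpM2l (normr_ge0 _) h3) _.
rewrite mulrCA mulr_sumr.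
under eq_bigr do rewrite -normrM.
rewrite -ler_pdivlMl// -[leRHS]mulrC invfM mulrA mulfV ?gt_eqF// mul1r invrK.
move: h2; rewrite ltr_distlC => /andP[_]; rewrite addrC => h2.
by rewrite /K [leRHS]addrC ltW// addrC.
Unshelve. all: by end_near. Qed.

End Taylor.

(** * C^1 functions on a box with positive sides *)

Section C1Box.
Set Implicit Arguments.
Unset Strict Implicit.
Context {R : realType} {m : nat} (tau : 'rV[R]_m) (tau_gt0 : forall a, 0 < tau 0 a).
Local Notation B := (box tau).
Implicit Types (f g : 'rV[R]_m -> R) (a : 'I_m) (t : 'rV[R]_m).

(** A side of positive length leaves room to move: forward below the upper face, backward on it.
    This makes limits along the increments unique. *)
Lemma box_incr_proper a t : B t -> ProperFilter (incr B a t).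
Proof.
move=> Bt; split; last exact: within_filter.
suff : ~ \forall s \near incr B a t, False by [].
rewrite /incr near_withinE /dnbhs near_withinE => /nbhs_ballP[e /= e0 H].
have [ta0 tat] : 0 <= t 0 a /\ t 0 a <= tau 0 a by apply/andP.
have move_in s : 0 <= t 0 a + s <= tau 0 a -> B (t + s *: basis_vec a).
  move=> sI b; rewrite !mxE eqxx /=.
  have [->|_] := eqVneq b a; first by rewrite mulr1.
  by rewrite mulr0 addr0.
have ball_in (s : R) : `|s| < e -> ball (0 : R) e s by rewrite /ball /= sub0r normrN.
have [tlt|tge] := ltP (t 0 a) (tau 0 a).
- pose s := Num.min (e / 2) (tau 0 a - t 0 a).
  have s0 : 0 < s by rewrite lt_min divr_gt0//= subr_gt0.
  have se : s <= e / 2 by rewrite ge_min lexx.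
  have st : s <= tau 0 a - t 0 a by rewrite ge_min lexx orbT.
  apply: (H s); [|by rewrite gt_eqF|apply: move_in; lra].
  by apply: ball_in; rewrite gtr0_norm//; lra.
- pose s := Num.min (e / 2) (tau 0 a).
  have s0 : 0 < s by rewrite lt_min divr_gt0//=.
  have se : s <= e / 2 by rewrite ge_min lexx.
  have st : s <= tau 0 a by rewrite ge_min lexx orbT.
  apply: (H (- s)); [|by rewrite oppr_eq0 gt_eqF|apply: move_in; lra].
  by apply: ball_in; rewrite normrN gtr0_norm//; lra.
Qed.

Lemma pderiv_box_eq a f t l : B t -> is_pder B a f t l -> pderiv B a f t = l.
Proof. by move=> /(box_incr_proper a) pF; exact: cvg_lim. Qed.

Lemma eq_within_continuous f g : (forall t, B t -> f t = g t) ->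
  {within B, continuous f} -> {within B, continuous g}.
Proof.
move=> fg /subspace_continuousP cf; apply/subspace_continuousP => t Bt.
rewrite /from_subspace -(fg t Bt); apply: (near_cvg (cf t Bt)).
by rewrite near_withinE; apply: nearW => s; exact: fg.
Qed.

(** By uniqueness of limits, any continuous family of derivatives certifies C^1; the closure lemmas
    then only exhibit a formula, without computing [pderiv]. *)
Lemma class_C1_boxP f : class_C 1 B f <->
  {within B, continuous f} /\ exists df : 'I_m -> 'rV[R]_m -> R, forall a,
    (forall t, B t -> is_pder B a f t (df a t)) /\
    {within B, continuous (df a)}.
Proof.
split=> [[cf Hf]|[cf [df Hf]]]; split => //.
  by exists (fun a => pderiv B a f) => a; have [] := Hf a.
move=> a; have [fdf cdf] := Hf a; split.
  by move=> t /fdf H; apply/cvg_ex; exists (df a t).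
by apply: eq_within_continuous cdf => t Bt; rewrite (pderiv_box_eq Bt (fdf t Bt)).
Qed.

Lemma class_C1_box_pder f a t : class_C 1 B f -> B t ->
  is_pder B a f t (pderiv B a f t).
Proof. by move=> [_ /(_ a)[H _]] Bt; exact: H. Qed.

Lemma class_C1_box_pderiv f a : class_C 1 B f ->
  {within B, continuous (pderiv B a f)}.
Proof. by move=> [_ /(_ a)[]]. Qed.

Lemma eq_class_C1 f g : (forall t, B t -> f t = g t) ->
  class_C 1 B f -> class_C 1 B g.
Proof.
move=> fg /class_C1_boxP[cf [df Hf]]; apply/class_C1_boxP; split.
  exact: eq_within_continuous cf.
exists df => a; have [fdf cdf] := Hf a; split => // t Bt.
by apply: (eq_is_pder Bt fg); exact: fdf.
Qed.

Lemma class_C1_cst (c : R) : class_C 1 B (fun=> c).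
Proof.
apply/class_C1_boxP; split; first by move=> t; exact: cvg_cst.
exists (fun _ _ => 0) => a; split=> [t _|]; first exact: is_pder_cst.
by move=> t; exact: cvg_cst.
Qed.

Lemma class_C1D f g : class_C 1 B f -> class_C 1 B g ->
  class_C 1 B (fun t => f t + g t).
Proof.
move=> /class_C1_boxP[cf [df Hf]] /class_C1_boxP[cg [dg Hg]].
apply/class_C1_boxP; split; first by move=> t; apply: cvgD; [exact: cf|exact: cg].
exists (fun a t => df a t + dg a t) => a.
have [fdf cdf] := Hf a; have [gdg cdg] := Hg a; split.
  by move=> t Bt; apply: is_pderD; [exact: fdf|exact: gdg].
by move=> t; apply: cvgD; [exact: cdf|exact: cdg].
Qed.

Lemma class_C1M f g : class_C 1 B f -> class_C 1 B g ->
  class_C 1 B (fun t => f t * g t).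
Proof.
move=> /class_C1_boxP[cf [df Hf]] /class_C1_boxP[cg [dg Hg]].
apply/class_C1_boxP; split; first by move=> t; apply: cvgM; [exact: cf|exact: cg].
exists (fun a t => df a t * g t + f t * dg a t) => a.
have [fdf cdf] := Hf a; have [gdg cdg] := Hg a; split.
  by move=> t Bt; apply: is_pderM; [exact: fdf|exact: gdg].
by move=> t; apply: cvgD; apply: cvgM;
  [exact: cdf|exact: cg|exact: cf|exact: cdg].
Qed.

Lemma class_C1_sum I (r : seq I) (P : pred I) (F : I -> 'rV[R]_m -> R) :
  (forall i, P i -> class_C 1 B (F i)) ->
  class_C 1 B (fun t => \sum_(i <- r | P i) F i t).
Proof.
move=> CF; elim: r => [|i r IH].
  by under [X in class_C _ _ X]funext do rewrite big_nil; exact: class_C1_cst.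
under [X in class_C _ _ X]funext do rewrite big_cons.
by case: (boolP (P i)) => // Pi; exact: (class_C1D (CF _ Pi) IH).
Qed.

Lemma class_C1_prod I (r : seq I) (P : pred I) (F : I -> 'rV[R]_m -> R) :
  (forall i, P i -> class_C 1 B (F i)) ->
  class_C 1 B (fun t => \prod_(i <- r | P i) F i t).
Proof.
move=> CF; elim: r => [|i r IH].
  by under [X in class_C _ _ X]funext do rewrite big_nil; exact: class_C1_cst.
under [X in class_C _ _ X]funext do rewrite big_cons.
by case: (boolP (P i)) => // Pi; exact: (class_C1M (CF _ Pi) IH).
Qed.

Lemma class_C1V f : (forall t, B t -> f t != 0) -> class_C 1 B f ->
  class_C 1 B (fun t => (f t)^-1).
Proof.
move=> f0 /class_C1_boxP[cf [df Hf]].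
have cV : {within B, continuous (fun t => (f t)^-1)}.
  apply/subspace_continuousP => t Bt; apply: cvgV; first exact: f0.
  by move/subspace_continuousP : cf; exact.
apply/class_C1_boxP; split => //.
exists (fun a t => - df a t * ((f t)^-1 * (f t)^-1)) => a.
have [fdf cdf] := Hf a; split.
  by move=> t Bt; rewrite -invfM; apply: is_pderV; [exact: f0|exact: fdf].
move=> t; apply: cvgM; first by apply: cvgN; exact: cdf.
by apply: cvgM; exact: cV.
Qed.

Lemma class_C1_pos2 f : class_C 1 B f ->
  class_C 1 B (fun t => Num.max 0 (f t) ^+ 2).
Proof.
move=> /class_C1_boxP[cf [df Hf]].
have cpos : {within B, continuous (fun t => Num.max 0 (f t))}.
  by move=> t; apply: continuous_max; [exact: cvg_cst|exact: cf].
apply/class_C1_boxP; split.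
  by move=> t; exact: (cvgM (cpos t) (cpos t)).
exists (fun a t => 2 * Num.max 0 (f t) * df a t) => a.
have [fdf cdf] := Hf a; split.
  by move=> t Bt; apply: is_pder_pos2; exact: fdf.
by move=> t; apply: cvgM (cdf t); apply: cvgM (cpos t); exact: cvg_cst.
Qed.

Lemma is_pder_coord a b t : is_pder B a (fun s => s 0 b) t (b == a)%:R.
Proof.
rewrite /is_pder; apply: (near_cvg (cvg_cst _)).
apply: near_incr => s s0 _; rewrite /diff_quot !mxE eqxx /=; field.
exact: s0.
Qed.

Lemma class_C1_coord b : class_C 1 B (fun t => t 0 b).
Proof.
apply/class_C1_boxP; split.
  by apply: continuous_subspaceT => t; exact: coord_continuous.
exists (fun a _ => (b == a)%:R) => a; split=> [t _|]; first exact: is_pder_coord.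
by move=> t; exact: cvg_cst.
Qed.

Lemma class_C1_comp n (M : set 'rV[R]_n) (G : 'rV[R]_n -> R)
    (x : 'rV[R]_m -> 'rV[R]_n) : open M -> class_C 2 M G ->
  (forall t, B t -> M (x t)) -> (forall i, class_C 1 B (fun t => x t 0 i)) ->
  class_C 1 B (fun t => G (x t)).
Proof.
move=> oM CG BM Cx.
have C1G : class_C 1 M G by case: CG => cG H; split => // i; have [? []] := H i.
have cx i : {within B, continuous (fun t => x t 0 i)} by have [] := Cx i.
apply/class_C1_boxP; split.
  by apply: (within_continuous_open_comp oM) => //; case: CG.
exists (fun a t => \sum_i pderiv B a (fun s => x s 0 i) t * pderiv M i G (x t)) => a.
split=> [t Bt|].
  apply: (is_pder_chain oM C1G (BM t Bt)) => i; exact: class_C1_box_pder.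
move=> t; apply: cvg_big => [|i _]; first exact: add_continuous.
apply: cvgM; first by apply: class_C1_box_pderiv.
apply: (within_continuous_open_comp oM) => //.
by case: CG => _ /(_ i)[_ []].
Qed.

(** Fewer increments give a finer filter, so the same limits persist; on a new face a two-sided
    derivative becomes one-sided. This carries [h] from the orthant to the box. *)
Lemma class_C1_restrict D f : B `<=` D -> class_C 1 D f -> class_C 1 B f.
Proof.
move=> BD [cf Hf]; apply/class_C1_boxP; split; first exact: continuous_subspaceW cf.
exists (fun a => pderiv D a f) => a; have [fD cD] := Hf a; split.
  move=> t Bt; have := fD t (BD t Bt); apply: cvg_trans; apply: cvg_app.
  by apply: within_subset => s /=; exact: BD.
exact: continuous_subspaceW cD.
Qed.

End C1Box.

(** * Iterated integrals over a box *)

Section BoxIntegral.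
Set Implicit Arguments.
Unset Strict Implicit.
Context {R : realType}.

Lemma box_compact k (tau : 'rV[R]_k) : compact (box tau).
Proof.
have -> : box tau = [set t | forall i, `[0, tau 0 i]%classic (t ord0 i)].
  by apply/seteqP; split=> t /= H i; have := H i; rewrite /= in_itv.
by apply: (@rV_compact R k (fun i => `[0, tau 0 i]%classic)) => i; exact: segment_compact.
Qed.

(** Compactness turns a property that holds eventually along [F], locally uniformly in [t], into one
    that holds eventually for all [t] of the box at once. *)
Lemma near_box k (tau : 'rV[R]_k) I (F : set_system I) (FF : Filter F)
    (P : I -> 'rV[R]_k -> Prop) :
  (forall t, box tau t -> \forall t' \near t & i \near F, box tau t' -> P i t') ->
  \forall i \near F, forall t, box tau t -> P i t.
Proof.
move=> H; have /compact_near_coveringP/near_covering_withinP := @box_compact k tau.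
exact.
Qed.

(** Kept convertible to the vector built inside [box_integral], so that [box_integralS] holds by
    computation. *)
Definition row_cons l (s : R) (t : 'rV[R]_l) : 'rV[R]_l.+1 :=
  row_mx (const_mx s : 'rV[R]_1) t.

Definition row_tail l (t : 'rV[R]_l.+1) : 'rV[R]_l :=
  \row_(j < l) t 0 (lift ord0 j).

Lemma row_cons0 l s (t : 'rV[R]_l) : row_cons s t 0 ord0 = s.
Proof.
rewrite /row_cons; transitivity (row_mx (const_mx s : 'rV[R]_1) t 0 (lshift l ord0)).
  by congr (fun_of_matrix _ _ _); exact: val_inj.
by rewrite row_mxEl mxE.
Qed.

Lemma row_consS l s (t : 'rV[R]_l) j : row_cons s t 0 (lift ord0 j) = t 0 j.
Proof.
rewrite /row_cons; transitivity (row_mx (const_mx s : 'rV[R]_1) t 0 (rshift 1 j)).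
  by congr (fun_of_matrix _ _ _); exact: val_inj.
by rewrite row_mxEr.
Qed.

Lemma row_cons_tail l (t : 'rV[R]_l.+1) : row_cons (t 0 ord0) (row_tail t) = t.
Proof.
apply/rowP => j; case: (unliftP ord0 j) => [i|] ->; last by rewrite row_cons0.
by rewrite row_consS mxE.
Qed.

Lemma box_row_cons l (tau : 'rV[R]_l.+1) s t :
  box tau (row_cons s t) <-> 0 <= s <= tau 0 ord0 /\ box (row_tail tau) t.
Proof.
split=> [H|[H0 H] j].
  split; first by have := H ord0; rewrite row_cons0.
  by move=> j; have := H (lift ord0 j); rewrite row_consS mxE.
case: (unliftP ord0 j) => [i|] ->; last by rewrite row_cons0.
by have := H i; rewrite row_consS mxE.
Qed.

Lemma cvg_row_cons l T (F : set_system T) {FF : Filter F} (s : T -> R)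
    (t : T -> 'rV[R]_l) s0 t0 :
  s @ F --> s0 -> t @ F --> t0 -> row_cons (s u) (t u) @[u --> F] --> row_cons s0 t0.
Proof.
move=> ss0 tt0; apply: cvg_mx => i j; rewrite ord1.
case: (unliftP ord0 j) => [j'|] ->.
  rewrite row_consS; under eq_fun do rewrite row_consS.
  exact: (cvg_comp t (fun u : 'rV[R]_l => u 0 j') tt0 (@coord_continuous R 1 l 0 j' t0)).
by rewrite row_cons0; under eq_fun do rewrite row_cons0.
Qed.

Lemma within_continuous_row_cons l (tau : 'rV[R]_l.+1) (f : 'rV[R]_l.+1 -> R) s :
  0 <= s <= tau 0 ord0 -> {within box tau, continuous f} ->
  {within box (row_tail tau), continuous (fun t => f (row_cons s t))}.
Proof.
move=> sI /subspace_continuousP cf; apply/subspace_continuousP => t Bt.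
have Bst : box tau (row_cons s t) by apply/box_row_cons.
have cst : row_cons s t' @[t' --> within (box (row_tail tau)) (nbhs t)] --> row_cons s t.
  by apply: cvg_row_cons; [exact: cvg_cst|exact: cvg_within].
move=> P /(cf _ Bst) /= HP.
have HP1 : \forall t' \near within (box (row_tail tau)) (nbhs t),
  box tau (row_cons s t') -> P (f (row_cons s t')) := cst _ HP.
suff : \forall t' \near within (box (row_tail tau)) (nbhs t),
  P (f (row_cons s t')) by [].
move: HP1; rewrite !near_withinE; apply: filterS => t' HP1 Bt'.
by apply: HP1 => //; apply/box_row_cons.
Qed.

Lemma box_integralS l (tau : 'rV[R]_l.+1) f :
  box_integral tau f = Rintegral lebesgue_measure `[0, tau 0 ord0]
    (fun s => box_integral (row_tail tau) (fun t => f (row_cons s t))).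
Proof. by []. Qed.

(** One predicate of the dimension, because the induction needs both properties together: they bound
    the difference of two slice integrals, which makes these continuous in the remaining variable,
    hence integrable. *)
Definition box_integral_linear_monotone l := forall tau : 'rV[R]_l,
  (forall a, 0 < tau 0 a) -> forall f g : 'rV[R]_l -> R,
  {within box tau, continuous f} -> {within box tau, continuous g} ->
  (forall c, box_integral tau (fun t => c * f t + g t) =
     c * box_integral tau f + box_integral tau g) /\
  ((forall t, box tau t -> f t <= g t) ->
     box_integral tau f <= box_integral tau g).

Lemma row_tail_gt0 l (tau : 'rV[R]_l.+1) :
  (forall a, 0 < tau 0 a) -> forall a, 0 < row_tail tau 0 a.
Proof. by move=> tau0 a; rewrite mxE. Qed.

(** Integrate [f <= e + g] and [g <= e + f]. The constant is written [e * 1] to fit the linearity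
    clause. *)
Lemma box_integral_close l (tau : 'rV[R]_l) : box_integral_linear_monotone l ->
  (forall a, 0 < tau 0 a) -> forall (f g : 'rV[R]_l -> R) e,
  {within box tau, continuous f} -> {within box tau, continuous g} ->
  (forall t, box tau t -> `|f t - g t| <= e) ->
  `|box_integral tau f - box_integral tau g| <= e * box_integral tau (fun=> 1).
Proof.
move=> LM tau0 f g e cf cg fg.
have c1 : {within box tau, continuous (fun=> 1 : R)} by move=> t; exact: cvg_cst.
have ce (h : 'rV[R]_l -> R) : {within box tau, continuous h} ->
    {within box tau, continuous (fun t => e * 1 + h t)}.
  by move=> ch t; apply: cvgD (ch t); exact: cvg_cst.
have [lg _] := LM _ tau0 _ _ c1 cg; have [lf _] := LM _ tau0 _ _ c1 cf.
have [_ mf] := LM _ tau0 _ _ cf (ce _ cg); have [_ mg] := LM _ tau0 _ _ cg (ce _ cf).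
rewrite ler_norml; apply/andP; split.
  rewrite lerBrDr addrC lerBlDl -lf; apply: mg => t Bt.
  by have := fg t Bt; rewrite ler_norml => /andP[]; lra.
rewrite lerBlDr -lg; apply: mf => t Bt.
by have := fg t Bt; rewrite ler_norml => /andP[]; lra.
Qed.

(** Closeness of the zero function to itself, with slack [e = 1], already bounds 0 by the volume. *)
Lemma box_integral1_ge0 l (tau : 'rV[R]_l) : box_integral_linear_monotone l ->
  (forall a, 0 < tau 0 a) -> 0 <= box_integral tau (fun=> 1).
Proof.
move=> LM tau0.
have cc (c : R) : {within box tau, continuous (fun=> c : R)} by move=> t; exact: cvg_cst.
have := box_integral_close LM tau0 (cc 0) (cc 0) (e := 1).
by rewrite !subrr normr0 mul1r; apply.
Qed.

(** Both slices are compared with the value at one point [row_cons s0 t0], at a cost of [e / 2]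
    each; compactness makes this uniform in [t]. *)
Lemma row_cons_uniform l (tau : 'rV[R]_l.+1) (f : 'rV[R]_l.+1 -> R) s0 e :
  {within box tau, continuous f} -> 0 <= s0 <= tau 0 ord0 -> 0 < e ->
  \forall s \near within `[0, tau 0 ord0] (nbhs s0), forall t,
    box (row_tail tau) t -> `|f (row_cons s0 t) - f (row_cons s t)| <= e.
Proof.
move=> cf s0I e0.
apply: near_box => t0 Bt0.
have Bst : box tau (row_cons s0 t0) by apply/box_row_cons.
move/subspace_continuousP : cf => /(_ _ Bst)/cvgrPdist_lt/(_ (e / 2)).
rewrite divr_gt0// => /(_ isT); rewrite near_withinE => H.
have c1 : row_cons s0 (p : 'rV[R]_l * R).1 @[p --> filter_prod (nbhs t0)
    (within `[0, tau 0 ord0] (nbhs s0))] --> row_cons s0 t0.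
  by apply: cvg_row_cons; [exact: cvg_cst|exact: cvg_fst].
have c2 : row_cons (p : 'rV[R]_l * R).2 p.1 @[p --> filter_prod (nbhs t0)
    (within `[0, tau 0 ord0] (nbhs s0))] --> row_cons s0 t0.
  apply: cvg_row_cons; [|exact: cvg_fst].
  exact: cvg_trans cvg_snd (cvg_within _).
have I2 : \forall p \near filter_prod (nbhs t0) (within `[0, tau 0 ord0] (nbhs s0)),
    `[0, tau 0 ord0]%classic (p : 'rV[R]_l * R).2.
  by apply: (cvg_snd (F := nbhs t0)); exact: withinT.
pose near_f r := box tau r -> `|f (row_cons s0 t0) - f r| < e / 2.
have n1 : \forall p \near filter_prod (nbhs t0) (within `[0, tau 0 ord0] (nbhs s0)),
    near_f (row_cons s0 (p : 'rV[R]_l * R).1) := c1 _ H.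
have n2 : \forall p \near filter_prod (nbhs t0) (within `[0, tau 0 ord0] (nbhs s0)),
    near_f (row_cons (p : 'rV[R]_l * R).2 p.1) := c2 _ H.
suff : \forall p \near filter_prod (nbhs t0) (within `[0, tau 0 ord0] (nbhs s0)),
    box (row_tail tau) (p : 'rV[R]_l * R).1 ->
    `|f (row_cons s0 p.1) - f (row_cons p.2 p.1)| <= e by [].
apply: filterS3 n1 n2 I2 => -[t s] /= h1 h2; rewrite in_itv /= => sI Bt.
have b1 : box tau (row_cons s0 t) by apply/box_row_cons.
have b2 : box tau (row_cons s t) by apply/box_row_cons.
have := h1 b1; have := h2 b2; rewrite !ltr_norml => /andP[] ? ? /andP[] ? ?.
rewrite ler_norml; lra.
Qed.

Lemma inner_box_integral_continuous l (tau : 'rV[R]_l.+1) (f : 'rV[R]_l.+1 -> R) :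
  box_integral_linear_monotone l -> (forall a, 0 < tau 0 a) ->
  {within box tau, continuous f} ->
  {within `[0, tau 0 ord0], continuous
    (fun s => box_integral (row_tail tau) (fun t => f (row_cons s t)))}.
Proof.
move=> LM tau0 cf; apply/subspace_continuousP => s0 /=.
rewrite in_itv /= => s0I; apply/cvgrPdist_le => e e0.
set V := box_integral (row_tail tau) (fun=> 1).
have V0 : 0 <= V by exact: box_integral1_ge0 (row_tail_gt0 tau0).
have V1 : 0 < V + 1 by rewrite ltr_wpDl.
(* The volume [V] is only known to be nonnegative at this stage, hence the division by [V + 1]. *)
pose e' := e / (V + 1).
have e'0 : 0 < e' by rewrite divr_gt0.
have := row_cons_uniform cf s0I e'0.
rewrite !near_withinE; apply: filterS => s H /[dup] /= sI /H{}H.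
rewrite in_itv /= in sI.
have := box_integral_close LM (row_tail_gt0 tau0)
  (within_continuous_row_cons s0I cf) (within_continuous_row_cons sI cf) H.
by move/le_trans; apply; rewrite /e' mulrAC ler_pdivrMr// ler_wpM2l ?ltW// ltrDl.
Qed.

Lemma continuous_integrable (T : R) (J : R -> R) : {within `[0, T], continuous J} ->
  lebesgue_measure.-integrable `[0, T] (EFin \o J).
Proof.
by move=> cJ; apply: continuous_compact_integrable => //; exact: segment_compact.
Qed.

(** Induction on the dimension: the hypothesis makes the slice integrals continuous, so integrable,
    and the one-dimensional rules apply to them. *)
Lemma box_integralP l : box_integral_linear_monotone l.
Proof.
elim: l => [|l IH] tau tau0 f g cf cg.
  split=> [c|]; rewrite /box_integral//; apply => -[]//.
have cJf := inner_box_integral_continuous IH tau0 cf.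
have cJg := inner_box_integral_continuous IH tau0 cg.
have iJf := continuous_integrable cJf; have iJg := continuous_integrable cJg.
split=> [c|fg].
  rewrite !box_integralS -RintegralZl//= -RintegralD//=; last first.
    apply: continuous_integrable => s; apply: cvgM (cJf s); exact: cvg_cst.
  apply: eq_Rintegral => s /[!inE] /=; rewrite in_itv /= => sI.
  by have [-> _] := IH _ (row_tail_gt0 tau0) _ _
    (within_continuous_row_cons sI cf) (within_continuous_row_cons sI cg).
rewrite !box_integralS; apply: le_Rintegral => // s /=; rewrite in_itv /= => sI.
have [_] := IH _ (row_tail_gt0 tau0) _ _
    (within_continuous_row_cons sI cf) (within_continuous_row_cons sI cg).
by apply => t Bt; apply: fg; apply/box_row_cons.
Qed.

(** By continuity [J] stays above [J c / 2] on a subinterval, so it dominates a step function of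
    positive integral. *)
Lemma Rintegral_gt0 (T : R) (J : R -> R) c : {within `[0, T], continuous J} -> 0 < T ->
  (forall s, 0 <= s <= T -> 0 <= J s) -> 0 <= c <= T -> 0 < J c ->
  0 < Rintegral lebesgue_measure `[0, T] J.
Proof.
move=> cJ T0 J0 cI Jc.
have iJ := continuous_integrable cJ.
have : exists p q, [/\ 0 <= p, p < q, q <= T & forall s, p <= s <= q -> J c / 2 <= J s].
  move/subspace_continuousP : (cJ) => /(_ c) /=; rewrite in_itv /= => /(_ cI).
  move=> /cvgrPdist_lt/(_ (J c / 2)); rewrite divr_gt0// => /(_ isT).
  rewrite near_withinE => /nbhs_ballP[e /= e0 H].
  pose r := Num.min (e / 2) (T / 2).
  have r0 : 0 < r by rewrite lt_min !divr_gt0.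
  have re : r <= e / 2 by rewrite ge_min lexx.
  have rT : r <= T / 2 by rewrite ge_min lexx orbT.
  have JH s : `|c - s| < e -> 0 <= s <= T -> J c / 2 <= J s.
    move=> cs sI; have := H s cs; rewrite /= in_itv /= => /(_ sI).
    by rewrite /from_subspace ltr_norml => /andP[]; lra.
  (* The subinterval lies on the side of [c] with room at least [T / 2], so it stays in [0, T] even
     if [c] is an end point. *)
  have [cT|Tc] := leP c (T / 2).
    exists c, (c + r); split; [lra|lra|lra|move=> s sI; apply: JH; last lra].
    by rewrite ltr_norml; lra.
  exists (c - r), c; split; [lra|lra|lra|move=> s sI; apply: JH; last lra].
  by rewrite ltr_norml; lra.
move=> [p [q [p0 pq qT JpQ]]].
have sub : `[p, q] `<=` `[0, T] by move=> s; rewrite /= !in_itv /= => /andP[]; lra.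
pose K : R -> R := fun s => J c / 2 * \1_(`[p, q]%classic) s.
have iI : lebesgue_measure.-integrable `[0, T] (fun s : R => (\1_(`[p, q]%classic) s)%:E).
  apply: (integrableS measurableT) => //; exact: (integrable_indic_itv p q true false).
have iK : lebesgue_measure.-integrable `[0, T] (EFin \o K).
  rewrite (_ : _ \o _ = fun s => ((J c / 2)%:E * (\1_(`[p, q]%classic) s)%:E)%E); last first.
    by apply/funext => s; rewrite /= /K EFinM.
  exact: integrableZl.
apply: (@lt_le_trans _ _ (Rintegral lebesgue_measure `[0, T] K)).
  rewrite /Rintegral /K; under eq_integral do rewrite EFinM.
  rewrite integralZl//.
  have -> : (\int[lebesgue_measure]_(x in `[0%R, T]) (\1_(`[p, q]%classic) x)%:E =
      (q - p)%:E)%E.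
    transitivity (@lebesgue_measure R (`[p, q] `&` `[0, T])); first exact: integral_indic.
    by rewrite setIidl// lebesgue_measure_itv /= lte_fin pq.
  by rewrite -EFinM /= mulr_gt0// ?divr_gt0// subr_gt0.
apply: le_Rintegral => // s /=; rewrite in_itv /= => sI; rewrite /K indicE.
have [|_] := boolP (s \in _); last by rewrite mulr0 J0.
by rewrite inE /= in_itv /= mulr1; exact: JpQ.
Qed.

Lemma box_integral_gt0 l (tau : 'rV[R]_l) (f : 'rV[R]_l -> R) c : (forall a, 0 < tau 0 a) ->
  {within box tau, continuous f} -> (forall t, box tau t -> 0 <= f t) ->
  box tau c -> 0 < f c -> 0 < box_integral tau f.
Proof.
elim: l tau f c => [|l IH] tau f c tau0 cf f0 Bc fc.
  by rewrite /=; congr (0 < f _): fc; apply/rowP => -[].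
have /box_row_cons[cI Bc'] : box tau (row_cons (c 0 ord0) (row_tail c)) by rewrite row_cons_tail.
rewrite box_integralS; apply: (@Rintegral_gt0 _ _ (c 0 ord0)) => //.
- exact: inner_box_integral_continuous (@box_integralP l) tau0 cf.
- move=> s sI.
  have c0 : {within box (row_tail tau), continuous (fun=> 0 : R)} by move=> t; exact: cvg_cst.
  (* Linearity with [c = 1] and two zero functions reads I = I + I, which gives the integral of
     0. *)
  have [l0 _] := box_integralP (row_tail_gt0 tau0) c0 c0.
  have [_ m0] := box_integralP (row_tail_gt0 tau0) c0 (within_continuous_row_cons sI cf).
  have /eqP := l0 1; under [X in box_integral _ X]funext do rewrite mulr0 addr0.
  rewrite mul1r -[X in X == _]add0r (inj_eq (addIr _)) => /eqP I0; rewrite [leLHS]I0.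
  by apply: m0 => t Bt; apply: f0; apply/box_row_cons.
- apply: (IH _ _ (row_tail c)) => //; first exact: row_tail_gt0.
  + exact: within_continuous_row_cons.
  + by move=> t Bt; apply: f0; apply/box_row_cons.
  + by rewrite row_cons_tail.
Qed.

End BoxIntegral.

(** * Linearity, derivatives of slice integrals, integration by parts *)

Section BoxIntegralTheory.
Set Implicit Arguments.
Unset Strict Implicit.
Context {R : realType}.

Section Fixed.
Context {l : nat} (tau : 'rV[R]_l) (tau0 : forall a, 0 < tau 0 a).
Implicit Types f g : 'rV[R]_l -> R.

(** This is [box_integral_close] at [e = 0]; the two functions may differ off the box. *)
Lemma eq_box_integral f g : {within box tau, continuous f} ->
  (forall t, box tau t -> f t = g t) -> box_integral tau f = box_integral tau g.
Proof.
move=> cf fg; have cg := eq_within_continuous fg cf.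
have := box_integral_close (@box_integralP R l) tau0 cf cg (e := 0).
rewrite mul0r normr_le0 subr_eq0 => H; apply/eqP; apply: H => t Bt.
by rewrite fg// subrr normr0.
Qed.

Lemma le_box_integral f g : {within box tau, continuous f} ->
  {within box tau, continuous g} -> (forall t, box tau t -> f t <= g t) ->
  box_integral tau f <= box_integral tau g.
Proof. by move=> cf cg; have [_] := box_integralP tau0 cf cg. Qed.

Lemma box_integralZD c f g : {within box tau, continuous f} ->
  {within box tau, continuous g} ->
  box_integral tau (fun t => c * f t + g t) =
  c * box_integral tau f + box_integral tau g.
Proof. by move=> cf cg; have [] := box_integralP tau0 cf cg. Qed.

Lemma box_integralD f g : {within box tau, continuous f} ->
  {within box tau, continuous g} ->
  box_integral tau (fun t => f t + g t) = box_integral tau f + box_integral tau g.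
Proof.
move=> cf cg; rewrite -[X in _ = X + _]mul1r -box_integralZD//.
by congr box_integral; apply/funext => t; rewrite mul1r.
Qed.

Lemma box_integral0 : box_integral tau (fun=> 0) = 0.
Proof.
have c0 : {within box tau, continuous (fun=> 0 : R)} by move=> t; exact: cvg_cst.
have := box_integralD c0 c0; under [X in box_integral _ X = _]funext do rewrite addr0.
by move/eqP; rewrite -[X in X == _]addr0 (inj_eq (addrI _)) => /eqP <-.
Qed.

Lemma box_integralZ c f : {within box tau, continuous f} ->
  box_integral tau (fun t => c * f t) = c * box_integral tau f.
Proof.
move=> cf; have c0 : {within box tau, continuous (fun=> 0 : R)} by move=> t; exact: cvg_cst.
have := box_integralZD c cf c0; rewrite box_integral0 addr0 => <-.
by congr box_integral; apply/funext => t; rewrite addr0.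
Qed.

Lemma box_integral_sum n (F : 'I_n -> 'rV[R]_l -> R) :
  (forall i, {within box tau, continuous (F i)}) ->
  box_integral tau (fun t => \sum_i F i t) = \sum_i box_integral tau (F i).
Proof.
elim: n F => [|n IH] F cF.
  by rewrite big_ord0; under [X in box_integral _ X = _]funext do rewrite big_ord0; exact: box_integral0.
rewrite big_ord_recl -IH//.
under [X in box_integral _ X = _]funext do rewrite big_ord_recl.
apply: box_integralD => // t; apply: cvg_big => [|i _]; first exact: add_continuous.
exact: cF.
Qed.

End Fixed.

Lemma line_coord k (t : 'rV[R]_k) z a j :
  (t + z *: basis_vec a) 0 j = t 0 j + z * (j == a)%:R.
Proof. by rewrite !mxE eqxx. Qed.

Lemma row_consDS l s (t : 'rV[R]_l) z a :
  row_cons s (t + z *: basis_vec a) = row_cons s t + z *: basis_vec (lift ord0 a).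
Proof.
apply/rowP => j; case: (unliftP ord0 j) => [i|] ->.
  by rewrite line_coord !row_consS line_coord (inj_eq lift_inj).
by rewrite line_coord !row_cons0 (negbTE (neq_lift _ _)) mulr0 addr0.
Qed.

Lemma row_consD0 l s (t : 'rV[R]_l) z :
  row_cons (s + z) t = row_cons s t + z *: basis_vec ord0.
Proof.
apply/rowP => j; case: (unliftP ord0 j) => [i|] ->.
  by rewrite line_coord !row_consS eq_sym (negbTE (neq_lift _ _)) mulr0 addr0.
by rewrite line_coord !row_cons0 eqxx mulr1.
Qed.

Lemma is_pder_row_cons l (tau : 'rV[R]_l.+1) f s t a d :
  0 <= s <= tau 0 ord0 ->
  is_pder (box tau) (lift ord0 a) f (row_cons s t) d ->
  is_pder (box (row_tail tau)) a (fun t => f (row_cons s t)) t d.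
Proof.
move=> sI; rewrite /is_pder /incr.
have -> : diff_quot (fun t => f (row_cons s t)) a t =
    diff_quot f (lift ord0 a) (row_cons s t).
  by apply/funext => z; rewrite /diff_quot row_consDS.
have -> // : [set z | box (row_tail tau) (t + z *: basis_vec a)] =
  [set z | box tau (row_cons s t + z *: basis_vec (lift ord0 a))].
apply/seteqP; split => z /=; first by move=> H; rewrite -row_consDS; apply/box_row_cons.
by rewrite -row_consDS => /box_row_cons[].
Qed.

(** The mean value estimate and the uniform continuity of [df] in [s] bound the first-order
    remainder by a small multiple of |h|, uniformly in [t]; this bound is then integrated over the
    slice. *)
Lemma inner_box_integral_derive l (tau : 'rV[R]_l.+1) (f df : 'rV[R]_l.+1 -> R) s :
  (forall a, 0 < tau 0 a) ->
  {within box tau, continuous f} -> {within box tau, continuous df} ->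
  (forall t, box tau t -> is_pder (box tau) ord0 f t (df t)) ->
  0 < s < tau 0 ord0 ->
  is_derive s 1 (fun s => box_integral (row_tail tau) (fun t => f (row_cons s t)))
    (box_integral (row_tail tau) (fun t => df (row_cons s t))).
Proof.
move=> tau0 cf cdf fdf /andP[s0 sT]; apply: is_derive_of_cvg.
have sI : 0 <= s <= tau 0 ord0 by rewrite !ltW.
apply/cvgrPdist_le => e e0.
set V := box_integral (row_tail tau) (fun=> 1).
have V0 : 0 <= V by exact: box_integral1_ge0 (@box_integralP _ l) (row_tail_gt0 tau0).
have V1 : 0 < V + 1 by rewrite ltr_wpDl.
have e'0 : 0 < e / (V + 1) by rewrite divr_gt0.
have := row_cons_uniform cdf sI e'0; rewrite near_withinE => /nbhs_ballP[r /= r0 H].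
rewrite /dnbhs near_withinE; apply/nbhs_ballP.
exists (Num.min r (Num.min s (tau 0 ord0 - s))) => /=.
  by rewrite !lt_min r0 s0 subr_gt0.
move=> h; rewrite /ball /= sub0r normrN !lt_min => /andP[hr /andP[hs hT]] h0.
have hI th : 0 <= th <= 1 -> 0 <= s + th * h <= tau 0 ord0 /\ `|th * h| < r.
  move=> /andP[th0 th1].
  have : `|th * h| <= `|h| by rewrite normrM ger0_norm// ler_piMl.
  move=> thh; split; last exact: le_lt_trans hr.
  have := le_lt_trans thh hs; have := le_lt_trans thh hT.
  by rewrite !ltr_norml => /andP[? ?] /andP[? ?]; lra.
have shI : 0 <= s + h <= tau 0 ord0 by have [|+ _] := hI 1; rewrite ?mul1r// ler01 lexx.
have cfs := within_continuous_row_cons sI cf.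
have cfsh := within_continuous_row_cons shI cf.
have cdfs := within_continuous_row_cons sI cdf.
have tt0 := row_tail_gt0 tau0.
have close t : box (row_tail tau) t ->
    `|f (row_cons (s + h) t) - (h * df (row_cons s t) + f (row_cons s t))|
      <= e / (V + 1) * `|h|.
  move=> Bt; rewrite opprD [- _ - _]addrC addrA row_consD0.
  apply: (@pder_mvt _ _ (box tau) ord0 f df) => // th /hI[thI thr].
    by rewrite -row_consD0; apply/box_row_cons.
  rewrite -row_consD0 distrC; apply: H => //=.
  by rewrite /ball /= opprD addrA subrr sub0r normrN.
have cg : {within box (row_tail tau), continuous
    (fun t => h * df (row_cons s t) + f (row_cons s t))}.
  by move=> t; apply: cvgD (cfs t); apply: cvgM (cdfs t); exact: cvg_cst.
have := box_integral_close (@box_integralP _ l) tt0 cfsh cg close.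
rewrite box_integralZD// -/V [h + s]addrC.
set Jh := box_integral _ _; set dJ := box_integral _ _; set J := box_integral _ _ => HJ.
rewrite (_ : dJ - _ = - (h^-1 * (Jh - (h * dJ + J)))); last by field.
rewrite normrN normrM normfV ler_pdivrMl ?normr_gt0//.
apply: le_trans HJ _.
rewrite [_ * `|h|]mulrC -mulrA ler_wpM2l//.
by rewrite mulrAC ler_pdivrMr// ler_wpM2l ?ltW// ltrDl.
Qed.

(** Integration by parts without boundary terms, once applied to a product. If [a] is the first
    coordinate, the slice integrals vanish at both ends and the fundamental theorem of calculus
    concludes; otherwise each slice integral is 0 by induction. *)
Lemma box_integral_pder0 l (tau : 'rV[R]_l) a (f df : 'rV[R]_l -> R) :
  (forall a, 0 < tau 0 a) ->
  {within box tau, continuous f} -> {within box tau, continuous df} ->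
  (forall t, box tau t -> is_pder (box tau) a f t (df t)) ->
  (forall t, box tau t -> t 0 a = 0 \/ t 0 a = tau 0 a -> f t = 0) ->
  box_integral tau df = 0.
Proof.
elim: l tau a f df => [|l IH] tau a f df tau0 cf cdf fdf fbd; first by case: a fdf fbd.
have tt0 := row_tail_gt0 tau0.
rewrite box_integralS; case: (unliftP ord0 a) => [a'|] aE.
  rewrite (@eq_Rintegral _ _ _ _ _ (fun=> 0)).
    by rewrite Rintegral_cst// mul0r.
  move=> s /[!inE] /=; rewrite in_itv /= => sI.
  apply: (IH _ a' (fun t => f (row_cons s t))) => //.
  - exact: within_continuous_row_cons.
  - exact: within_continuous_row_cons.
  - by move=> t Bt; apply: is_pder_row_cons => //; rewrite -aE; apply: fdf; apply/box_row_cons.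
  - move=> t Bt tb; apply: fbd; first by apply/box_row_cons.
    by move: tb; rewrite aE row_consS mxE.
rewrite aE in fdf fbd.
pose J s := box_integral (row_tail tau) (fun t => f (row_cons s t)).
pose dJ s := box_integral (row_tail tau) (fun t => df (row_cons s t)).
have cJ : {within `[0, tau 0 ord0], continuous J} :=
  inner_box_integral_continuous (@box_integralP _ l) tau0 cf.
have cdJ : {within `[0, tau 0 ord0], continuous dJ} :=
  inner_box_integral_continuous (@box_integralP _ l) tau0 cdf.
have JdJ s : s \in `]0, tau 0 ord0[ -> is_derive s 1 J (dJ s).
  by rewrite in_itv /= => sI; exact: inner_box_integral_derive.
have dLR : derivable_oo_LRcontinuous J 0 (tau 0 ord0).
  have /(continuous_within_itvP _ (tau0 ord0))[_ c0 cT] := cJ.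
  by split=> // s /JdJ[].
have J0 s : s = 0 \/ s = tau 0 ord0 -> J s = 0.
  move=> sE; have sI : 0 <= s <= tau 0 ord0.
    by case: sE => ->; rewrite lexx ltW.
  rewrite /J -(box_integral0 tt0); apply: eq_box_integral => //.
    exact: within_continuous_row_cons.
  by move=> t Bt; apply: fbd; [apply/box_row_cons|rewrite row_cons0].
rewrite /Rintegral (continuous_FTC2 (tau0 ord0) cdJ dLR).
  by rewrite (J0 0); [rewrite J0 /= ?subrr//; right|left].
by move=> s /JdJ sd; rewrite derive1E; exact: derive_val.
Qed.

End BoxIntegralTheory.

(** * Uniform first-order expansions *)

Section Jets.
Set Implicit Arguments.
Unset Strict Implicit.
Context {R : realType} {T : Type} (B : set T).
Implicit Types (F : R -> T -> R) (f G : T -> R).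

(** The expansion F s = f + s G + o(s), uniform on [B] so that it can be integrated. The bounds on
    [f] and [G] are what products of expansions need. *)
Definition jet F f G : Prop :=
  (exists C, forall t, B t -> `|f t| <= C /\ `|G t| <= C) /\
  forall e, 0 < e -> \forall s \near (0 : R), forall t, B t ->
    `|F s t - f t - s * G t| <= e * `|s|.

Lemma jet_affine f G C : (forall t, B t -> `|f t| <= C /\ `|G t| <= C) ->
  jet (fun s t => f t + s * G t) f G.
Proof.
move=> fC; split; first by exists C.
move=> e e0; near=> s => t Bt.
rewrite (_ : _ - _ = 0); last by ring.
by rewrite normr0 mulr_ge0// ltW.
Unshelve. all: by end_near. Qed.

Lemma jetD F1 f1 G1 F2 f2 G2 : jet F1 f1 G1 -> jet F2 f2 G2 ->
  jet (fun s t => F1 s t + F2 s t) (fun t => f1 t + f2 t) (fun t => G1 t + G2 t).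
Proof.
move=> [[C1 B1] J1] [[C2 B2] J2]; split.
  exists (C1 + C2) => t Bt; have [? ?] := B1 t Bt; have [? ?] := B2 t Bt.
  by split; rewrite (le_trans (ler_normD _ _))// lerD.
move=> e e0; have e2 : 0 < e / 2 by rewrite divr_gt0.
move: (J1 _ e2) (J2 _ e2); apply: filterS2 => s H1 H2 t Bt.
rewrite (_ : _ - _ = (F1 s t - f1 t - s * G1 t) + (F2 s t - f2 t - s * G2 t)); last by ring.
by rewrite (le_trans (ler_normD _ _))// [e]splitr mulrDl lerD// ?H1 ?H2.
Qed.

(** With r1, r2 the remainders of the factors, that of the product is r1 F2 + (f1 + s G1) r2 + s^2
    G1 G2. *)
Lemma jetM F1 f1 G1 F2 f2 G2 : jet F1 f1 G1 -> jet F2 f2 G2 ->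
  jet (fun s t => F1 s t * F2 s t) (fun t => f1 t * f2 t)
    (fun t => G1 t * f2 t + f1 t * G2 t).
Proof.
move=> [[C1 B1] J1] [[C2 B2] J2].
pose C := 1 + `|C1| + `|C2|.
have C0 : 1 <= C by rewrite /C -addrA lerDl addr_ge0.
have Cp : 0 < C by lra.
have bnd t : B t -> [/\ `|f1 t| <= C, `|G1 t| <= C, `|f2 t| <= C & `|G2 t| <= C].
  move=> Bt; have [? ?] := B1 t Bt; have [? ?] := B2 t Bt.
  have := ler_norm C1; have := ler_norm C2; have := normr_ge0 C1; have := normr_ge0 C2.
  by rewrite /C => *; split; lra.
split.
  exists (C * C + C * C) => t Bt; have [? ? ? ?] := bnd t Bt.
  have CC : 0 <= C * C by rewrite mulr_ge0 ?ltW.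
  split; first by rewrite normrM (@le_trans _ _ (C * C))// ?ler_pM// lerDl.
  by rewrite (le_trans (ler_normD _ _))// !normrM lerD// ler_pM.
(* The cofactors of the two remainders are at most [3 * C] and [2 * C]; with remainders of size d
   |s| the cost is 5 C d |s|, kept below half of e |s|. *)
move=> e e0; pose d := Num.min 1 (e / (10 * C)).
have d0 : 0 < d by rewrite lt_min ltr01 divr_gt0// mulr_gt0.
have d1 : d <= 1 by rewrite ge_min lexx.
have dC : d * (5 * C) <= e / 2.
  have : d <= e / (10 * C) by rewrite ge_min lexx orbT.
  rewrite ler_pdivlMr; last by rewrite mulr_gt0.
  by lra.
(* This radius leaves the other half to the quadratic term, since |G1 G2| <= C^2. *)
have s2 : 0 < Num.min 1 (e / (2 * (C * C))) by rewrite lt_min ltr01 divr_gt0// !mulr_gt0.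
have small : \forall s \near (0 : R), `|s| < Num.min 1 (e / (2 * (C * C))).
  apply/nbhs_ballP; exists (Num.min 1 (e / (2 * (C * C)))) => // s.
  by rewrite /ball /= sub0r normrN.
move: (J1 _ d0) (J2 _ d0) small; apply: filterS3 => s H1 H2.
rewrite lt_min => /andP[sle1 sC] t Bt.
have [f1C G1C f2C G2C] := bnd t Bt; have {}H1 := H1 t Bt; have {}H2 := H2 t Bt.
have s0 := normr_ge0 s.
have sG1 : `|s * G1 t| <= C by rewrite normrM -[leRHS]mul1r ler_pM// ltW.
have sG2 : `|s * G2 t| <= C by rewrite normrM -[leRHS]mul1r ler_pM// ltW.
have ds : d * `|s| <= 1 by rewrite -[leRHS]mul1r ler_pM// ltW.
have F2C : `|F2 s t| <= 3 * C.
  rewrite (_ : F2 s t = (F2 s t - f2 t - s * G2 t) + (f2 t + s * G2 t)); last by ring.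
  rewrite (le_trans (ler_normD _ _))//.
  by have := ler_normD (f2 t) (s * G2 t); lra.
have fG : `|f1 t + s * G1 t| <= 2 * C.
  by rewrite (le_trans (ler_normD _ _))//; lra.
rewrite (_ : _ - _ = (F1 s t - f1 t - s * G1 t) * F2 s t +
  ((f1 t + s * G1 t) * (F2 s t - f2 t - s * G2 t) + s * s * (G1 t * G2 t))); last by ring.
have h1 : `|(F1 s t - f1 t - s * G1 t) * F2 s t| <= d * `|s| * (3 * C).
  by rewrite normrM ler_pM.
have h2 : `|(f1 t + s * G1 t) * (F2 s t - f2 t - s * G2 t)| <= 2 * C * (d * `|s|).
  by rewrite normrM ler_pM.
have h3 : `|s * s * (G1 t * G2 t)| <= `|s| * (e / 2).
  rewrite -mulrA normrM ler_wpM2l// normrM.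
  have : `|G1 t * G2 t| <= C * C by rewrite normrM ler_pM.
  have CC : 0 < 2 * (C * C) by rewrite !mulr_gt0.
  move/(ler_pM s0 (normr_ge0 _) (lexx _))/le_trans; apply.
  by move: sC; rewrite ltr_pdivlMr//; lra.
have h4 := ler_normD ((F1 s t - f1 t - s * G1 t) * F2 s t)
  ((f1 t + s * G1 t) * (F2 s t - f2 t - s * G2 t) + s * s * (G1 t * G2 t)).
have h5 := ler_normD ((f1 t + s * G1 t) * (F2 s t - f2 t - s * G2 t)) (s * s * (G1 t * G2 t)).
have h6 : d * (5 * C) * `|s| <= e / 2 * `|s| by rewrite ler_wpM2r.
apply: (le_trans h4); apply: (@le_trans _ _ (d * `|s| * (3 * C) + (2 * C * (d * `|s|) + `|s| * (e / 2)))).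
  by apply: lerD => //; apply: (le_trans h5); exact: lerD.
by lra.
Qed.

Lemma jet_sum n (F : 'I_n -> R -> T -> R) (f G : 'I_n -> T -> R) :
  (forall i, jet (F i) (f i) (G i)) ->
  jet (fun s t => \sum_i F i s t) (fun t => \sum_i f i t) (fun t => \sum_i G i t).
Proof.
move=> H; elim: n F f G H => [|n IH] F f G H.
  split; first by exists 0 => t _; rewrite !big_ord0 normr0.
  move=> e e0; near=> s => t _.
  by rewrite !big_ord0 mulr0 !subr0 normr0 mulr_ge0// ltW.
have := jetD (H ord0) (IH _ _ _ (fun i => H (lift ord0 i))).
set F1 := fun s t => _; set f1 := fun t => _; set G1 := fun t => _.
rewrite (_ : F1 = fun s t => \sum_i F i s t); last by apply/funext => s; apply/funext => t; rewrite big_ord_recl.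
rewrite (_ : f1 = fun t => \sum_i f i t); last by apply/funext => t; rewrite big_ord_recl.
by rewrite (_ : G1 = fun t => \sum_i G i t)//; apply/funext => t; rewrite big_ord_recl.
Unshelve. all: by end_near. Qed.

End Jets.

(** * Uniform estimates from compactness of the box *)

Section UniformOnBox.
Set Implicit Arguments.
Unset Strict Implicit.
Context {R : realType} {m : nat} (tau : 'rV[R]_m).
Local Notation B := (box tau).

Lemma near_box_within I (F : set_system I) {FF : Filter F}
    (P : I -> 'rV[R]_m -> Prop) :
  (forall t, B t -> \forall p \near filter_prod (within B (nbhs t)) F, P p.2 p.1) ->
  \forall i \near F, forall t, B t -> P i t.
Proof.
move=> H; apply: near_box => t Bt.
have [[A C] /= [wA FC] AC] := H t Bt.
by exists ([set t' | B t' -> A t'], C) => // -[t' i] /= [At' Ci] Bt'; apply: (AC (t', i)); split => //=; exact: At'.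
Qed.

Lemma box_bounded (f : 'rV[R]_m -> R) : {within B, continuous f} ->
  exists C, forall t, B t -> `|f t| <= C.
Proof.
move=> cf; have := continuous_compact cf (@box_compact R m tau).
move=> /compact_bounded[C [_ H]]; exists (C + 1) => t Bt.
by apply: (H (C + 1)); [rewrite ltrDl|exists t].
Qed.

Lemma cvg_fst_within (f : 'rV[R]_m -> R) t I (F : set_system I) {FF : Filter F} :
  {within B, continuous f} -> B t ->
  f p.1 @[p --> filter_prod (within B (nbhs t)) F] --> f t.
Proof.
move=> /subspace_continuousP cf Bt.
exact: (cvg_comp fst f cvg_fst (cf t Bt)).
Qed.

Section Shift.
Context {n : nat} (x : 'rV[R]_m -> 'rV[R]_n) (eta : 'rV[R]_m -> R) (k : 'I_n).
Context (cx : forall i, {within B, continuous (fun t => x t 0 i)})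
  (ceta : {within B, continuous eta}).

(** The property is asked along the whole segment because [jet_shift] applies a mean value estimate
    there; [th = 0] and [th = 1] are the original and the shifted point. *)
Lemma near_shift t (Q : 'rV[R]_n -> Prop) : B t -> (\forall y \near x t, Q y) ->
  \forall p \near filter_prod (within B (nbhs t)) (nbhs (0 : R)),
    forall th, 0 <= th <= 1 -> Q (x p.1 + (th * (p.2 * eta p.1)) *: basis_vec k).
Proof.
move=> Bt /nbhs_ballP[r /= r0 Qr].
have r20 : 0 < r / 2 by rewrite divr_gt0.
have H1 : \forall p \near filter_prod (within B (nbhs t)) (nbhs (0 : R)),
    forall i, `|x t 0 i - x p.1 0 i| < r / 2.
  apply: filter_forall => i.
  have cxi : x p.1 0 i @[p --> filter_prod (within B (nbhs t)) (nbhs (0 : R))] --> x t 0 i.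
    exact: (cvg_fst_within (@cx i) Bt).
  by move/cvgrPdist_lt : cxi => /(_ _ r20).
have H2 : \forall p \near filter_prod (within B (nbhs t)) (nbhs (0 : R)),
    `|p.2 * eta p.1| < r / 2.
  have : p.2 * eta p.1 @[p --> filter_prod (within B (nbhs t)) (nbhs (0 : R))] --> 0 * eta t.
    by apply: cvgM; [exact: cvg_snd|exact: cvg_fst_within ceta Bt].
  rewrite mul0r => /cvgrPdist_lt/(_ _ r20).
  by apply: filterS => p; rewrite sub0r normrN.
move: H1 H2; apply: filterS2 => -[t' s] /= H1 H2 th /andP[th0 th1].
apply: Qr; split => // i0 i; rewrite ord1 /ball /= line_coord opprD addrA.
rewrite (le_lt_trans (ler_normB _ _))// [ltRHS]splitr ltr_leD//.
apply: (@le_trans _ _ `|s * eta t'|); last exact: ltW.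
rewrite -mulrA normrM (ger0_norm th0).
apply: (@le_trans _ _ `|s * eta t' * (i == k)%:R|); first by rewrite ler_piMl.
rewrite normrM ler_piMr//.
by case: (i == k); rewrite ?normr1 ?normr0.
Qed.

Lemma near_shift_all (Q : 'rV[R]_n -> Prop) : (forall t, B t -> \forall y \near x t, Q y) ->
  \forall s \near (0 : R), forall t, B t -> Q (x t + (s * eta t) *: basis_vec k).
Proof.
move=> HQ; apply: (near_box_within (F := nbhs (0 : R))) => t Bt.
apply: filterS (near_shift Bt (HQ t Bt)) => -[t' s] /= /(_ 1).
by rewrite mul1r ler01 lexx; apply.
Qed.

(** Only coordinate [k] moves, so the one-variable estimate [pder_mvt] suffices, with the slope at
    the unshifted point as constant. *)
Lemma jet_shift (M : set 'rV[R]_n) (G : 'rV[R]_n -> R) : open M ->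
  class_C 1 M G -> (forall t, B t -> M (x t)) ->
  jet B (fun s t => G (x t + (s * eta t) *: basis_vec k)) (fun t => G (x t))
    (fun t => eta t * pderiv M k G (x t)).
Proof.
move=> oM CG BM.
have cG : {within B, continuous (fun t => G (x t))}.
  by apply: (within_continuous_open_comp oM) => //; case: CG.
have cdG : {within B, continuous (fun t => pderiv M k G (x t))}.
  by apply: (within_continuous_open_comp oM) => //; case: CG => _ /(_ k)[].
split.
  have [C1 B1] := box_bounded cG.
  have [C2 B2] : exists C, forall t, B t -> `|eta t * pderiv M k G (x t)| <= C.
    by apply: box_bounded => t; apply: cvgM; [exact: ceta|exact: cdG].
  exists (`|C1| + `|C2|) => t Bt; split.
    by rewrite (le_trans (B1 t Bt))// (le_trans (ler_norm _))// lerDl.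
  by rewrite (le_trans (B2 t Bt))// (le_trans (ler_norm _))// lerDr.
move=> e e0.
have [C HC] := box_bounded ceta.
(* The increment is [s * eta t], so the slope error is divided by a bound of [eta]. *)
pose K := `|C| + 1; have K0 : 0 < K by rewrite ltr_wpDl.
pose e' := e / K; have e'0 : 0 < e' by rewrite divr_gt0.
have e'2 : 0 < e' / 2 by rewrite divr_gt0.
apply: (near_box_within (F := nbhs (0 : R))) => t0 Bt0.
have nQ : \forall y \near x t0, M y /\ `|pderiv M k G (x t0) - pderiv M k G y| < e' / 2.
  near=> y; split; first by near: y; apply: open_nbhs_nbhs; split => //; exact: BM.
  near: y; have [_ /(_ k)[_]] := CG; rewrite /= continuous_open_subspace// => /(_ (x t0)).
  by rewrite inE => /(_ (BM _ Bt0))/cvgrPdist_lt/(_ _ e'2).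
have inB : \forall p \near filter_prod (within B (nbhs t0)) (nbhs (0 : R)), B p.1.
  by apply: (cvg_fst (G := nbhs (0 : R))); exact: withinT.
move: (near_shift Bt0 nQ) inB; apply: filterS2 => -[t s] /= H Bt.
have := @pder_mvt R n M k G (pderiv M k G) (x t) (s * eta t) (pderiv M k G (x t)) e'.
rewrite -mulrA; move/(_ _ _ _)/le_trans; apply.
- by move=> th /H[].
- by move=> y My; exact: class_C1_is_pder.
- move=> th /H[_]; have [_] := H 0 (ltac:(by rewrite lexx ler01)).
  rewrite mul0r scale0r addr0 !ltr_norml => /andP[? ?] /andP[? ?].
  by rewrite ler_norml; lra.
rewrite normrM [`|s| * _]mulrC mulrA ler_wpM2r// /e' mulrAC ler_pdivrMr// ler_wpM2l ?ltW//.
by rewrite /K (le_lt_trans (HC t Bt))// (le_lt_trans (ler_norm _))// ltrDl.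
Unshelve. all: by end_near. Qed.

End Shift.

Lemma cvg_det p I (F : set_system I) {FF : Filter F} (A : I -> 'M[R]_p) (L : 'M[R]_p) :
  (forall i j, A u i j @[u --> F] --> L i j) -> \det (A u) @[u --> F] --> \det L.
Proof.
move=> AL; apply: cvg_big => [|s _]; first exact: add_continuous.
apply: cvgM; first exact: cvg_cst.
by apply: cvg_big => [|i _]; [exact: mul_continuous|exact: AL].
Qed.

(** With [A] a right inverse of [u t], the determinant of the perturbed product with [A] is near 1,
    so nonzero; hence the perturbed matrix still has a right inverse. Compactness gives one range of
    [s] for the whole box. *)
Lemma near_row_free p q (u V : 'rV[R]_m -> 'M[R]_(p, q)) :
  (forall i j, {within B, continuous (fun t => u t i j)}) ->
  (forall i j, {within B, continuous (fun t => V t i j)}) ->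
  (forall t, B t -> row_free (u t)) ->
  \forall s \near (0 : R), forall t, B t -> row_free (u t + s *: V t).
Proof.
move=> cu cV fu; apply: (near_box_within (F := nbhs (0 : R))) => t Bt.
have /row_freeP[A uA] := fu t Bt.
have : \det ((u r.1 + r.2 *: V r.1) *m A)
    @[r --> filter_prod (within B (nbhs t)) (nbhs (0 : R))] --> \det (u t *m A).
  apply: cvg_det => i j; rewrite mxE; under eq_fun do rewrite mxE.
  apply: cvg_big => [|k _]; first exact: add_continuous.
  apply: cvgM; last exact: cvg_cst.
  under eq_fun do rewrite !mxE.
  have -> : u t i k = u t i k + 0 * V t i k by rewrite mul0r addr0.
  apply: cvgD; first exact: (cvg_fst_within (cu i k) Bt).
  by apply: cvgM; [exact: cvg_snd|exact: (cvg_fst_within (cV i k) Bt)].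
rewrite uA det1 => /cvgrPdist_lt/(_ _ ltr01).
apply: filterS => -[t' s] /= H.
have : (u t' + s *: V t') *m A \in unitmx.
  rewrite unitmxE unitfE; apply: contraTN H => /eqP ->.
  by rewrite subr0 normr1 ltxx.
move=> /mulmxV; rewrite -mulmxA => E; apply/row_freeP; eexists; exact: E.
Qed.

End UniformOnBox.

(** * A bump with explicit first and second derivatives *)

Section Bump.
Set Implicit Arguments.
Unset Strict Implicit.
Context {R : realType} {m : nat} (tau : 'rV[R]_m) (tau0 : forall a, 0 < tau 0 a)
  (c : 'rV[R]_m) (rho : R) (rho0 : 0 < rho).
Local Notation B := (box tau).
Implicit Types (t : 'rV[R]_m) (a b : 'I_m).

(* [bump] is [max(0, paraboloid)^3], written so that [is_pder_pos2] and the product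
   rule suffice to differentiate it twice. *)
Definition paraboloid t : R :=
  rho ^+ 2 + \sum_b (-1) * ((t 0 b - c 0 b) * (t 0 b - c 0 b)).

Definition bump t : R := paraboloid t * Num.max 0 (paraboloid t) ^+ 2.

Definition dbump a t : R :=
  3 * Num.max 0 (paraboloid t) ^+ 2 * (-2 * (t 0 a - c 0 a)).

Lemma is_pder_affine a b t : is_pder B a (fun s => s 0 b - c 0 b) t (b == a)%:R.
Proof.
apply: is_pder_eq.
  by apply: is_pderD; [exact: is_pder_coord|exact: is_pder_cst].
by rewrite addr0.
Qed.

Lemma class_C1_affine b : class_C 1 B (fun s => s 0 b - c 0 b).
Proof. exact: class_C1D (class_C1_coord _ _) (class_C1_cst tau0 (- c 0 b)). Qed.

Lemma is_pder_paraboloid a t : is_pder B a paraboloid t (-2 * (t 0 a - c 0 a)).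
Proof.
apply: is_pder_eq.
  apply: is_pderD; first exact: is_pder_cst.
  apply: is_pder_sum => b _; apply: is_pderM; first exact: is_pder_cst.
  by apply: is_pderM; exact: is_pder_affine.
rewrite (bigD1 a)//= big1 => [|b ba]; first by rewrite eqxx /=; ring.
by rewrite (negbTE ba) /=; ring.
Qed.

Lemma class_C1_paraboloid : class_C 1 B paraboloid.
Proof.
apply: class_C1D => //; first exact: class_C1_cst.
apply: class_C1_sum => // b _; apply: class_C1M => //; first exact: class_C1_cst.
by apply: class_C1M => //; exact: class_C1_affine.
Qed.

(** The product rule gives max(0, q)^2 + 2 q max(0, q) times the derivative of the paraboloid q, and
    q max(0, q) = max(0, q)^2 for either sign of q. *)
Lemma is_pder_bump a t : is_pder B a bump t (dbump a t).
Proof.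
apply: is_pder_eq.
  by apply: is_pderM; [|apply: is_pder_pos2]; exact: is_pder_paraboloid.
rewrite /dbump; have [q0|q0] := leP 0 (paraboloid t); first by ring.
by rewrite expr0n /=; ring.
Qed.

Lemma class_C1_bump : class_C 1 B bump.
Proof.
apply: class_C1M => //; first exact: class_C1_paraboloid.
by apply: class_C1_pos2 => //; exact: class_C1_paraboloid.
Qed.

Lemma class_C1_dbump a : class_C 1 B (dbump a).
Proof.
apply: class_C1M => //.
  apply: class_C1M => //; first exact: class_C1_cst.
  by apply: class_C1_pos2 => //; exact: class_C1_paraboloid.
by apply: class_C1M => //; [exact: class_C1_cst|exact: class_C1_affine].
Qed.

(** The Hessian is computed and seen to be symmetric; this is what preserves complete integrability
    of the controls. *)
Lemma pderiv_dbumpC a b t : B t -> pderiv B b (dbump a) t = pderiv B a (dbump b) t.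
Proof.
move=> Bt.
(* Here 24 is 3 * 2 * (-2) * (-2), from differentiating the squared positive part, and 6 is 3 * 2,
   from the linear factor. *)
suff dE a' b' : pderiv B b' (dbump a') t =
    24 * Num.max 0 (paraboloid t) * (t 0 a' - c 0 a') * (t 0 b' - c 0 b')
    - 6 * Num.max 0 (paraboloid t) ^+ 2 * (a' == b')%:R.
  by rewrite !dE eq_sym; ring.
apply: pderiv_box_eq => //; apply: is_pder_eq.
  apply: is_pderM.
    apply: is_pderM; first exact: is_pder_cst.
    by apply: is_pder_pos2; exact: is_pder_paraboloid.
  by apply: is_pderM; [exact: is_pder_cst|exact: is_pder_affine].
by rewrite /=; ring.
Qed.

Lemma bump_le0 t : paraboloid t <= 0 -> bump t = 0.
Proof. by move=> q0; rewrite /bump (max_idPl q0) expr0n /= mulr0. Qed.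

Lemma dbump_le0 a t : paraboloid t <= 0 -> dbump a t = 0.
Proof. by move=> q0; rewrite /dbump (max_idPl q0) expr0n /= mulr0 mul0r. Qed.

Lemma bump_gt0 t : 0 < paraboloid t -> 0 < bump t.
Proof. by move=> q0; rewrite /bump (max_idPr (ltW q0)) mulr_gt0// exprn_gt0. Qed.

Lemma paraboloid_center : 0 < paraboloid c.
Proof.
rewrite /paraboloid big1 => [|b _]; first by rewrite addr0 exprn_gt0.
by rewrite subrr mulr0 mulr0.
Qed.

(** Positivity puts [t] within Euclidean distance [rho] of [c], so each coordinate is within [rho],
    which is all that [ball] asks. *)
Lemma paraboloid_gt0 t : 0 < paraboloid t -> ball c rho t.
Proof.
rewrite /paraboloid => q0; split => // i b; rewrite ord1 /ball /= distrC.
move: q0; rewrite (bigD1 b)//= => q0.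
have : \sum_(i < m | i != b) -1 * ((t 0 i - c 0 i) * (t 0 i - c 0 i)) <= 0.
  by apply: sumr_le0 => j _; rewrite mulN1r oppr_le0 -expr2 sqr_ge0.
move=> s0; have : (t 0 b - c 0 b) ^+ 2 < rho ^+ 2 by lra.
by move: (t 0 b - c 0 b) => z; apply: contraTT; rewrite -!leNgt => rz;
  rewrite -[leRHS]real_normK ?num_real// !expr2 ler_pM// ltW.
Qed.

End Bump.

(** * Derivatives and stationarity from a uniform expansion *)

Section FirstVariation.
Set Implicit Arguments.
Unset Strict Implicit.
Context {R : realType}.

Lemma jet_cst T (B : set T) (f : T -> R) C : (forall t, B t -> `|f t| <= C) ->
  jet B (fun _ t => f t) f (fun=> 0).
Proof.
move=> fC; have : jet B (fun s t => f t + s * 0) f (fun=> 0).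
  apply: (@jet_affine _ _ _ _ _ C) => t Bt; rewrite normr0; split; first exact: fC.
  exact: le_trans (fC t Bt).
rewrite (_ : (fun s t => _) = fun _ t => f t)//.
by apply/funext => s; apply/funext => t; rewrite mulr0 addr0.
Qed.

(** Lets the derivatives of the Lagrangian at one point be read off the expansion made for the
    energy. *)
Lemma jet_derive1 T (B : set T) (F : R -> T -> R) f G t (c : R) : jet B F f G ->
  B t -> F 0 t = f t -> derive1 (fun s => c * F s t) 0 = c * G t.
Proof.
move=> [_ J] Bt F0.
suff : is_derive (0 : R) 1 (fun s => c * F s t) (c * G t).
  by rewrite derive1E => H; exact: derive_val.
apply: is_derive_of_cvg.
have : c * (h^-1 * (F h t - f t)) @[h --> 0^'] --> c * G t.
  apply: cvgM; first exact: cvg_cst.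
  apply/cvgrPdist_le => e e0; have := J e e0.
  move=> H; rewrite /dnbhs near_withinE; apply: filterS H => s H s0.
  have {}H := H t Bt.
  rewrite distrC (_ : _ - _ = s^-1 * (F s t - f t - s * G t)).
    by rewrite normrM normfV ler_pdivrMl ?normr_gt0// [leRHS]mulrC.
  by field; exact: s0.
move/near_cvg; apply; apply: nearW => h.
by rewrite addr0 F0; ring.
Qed.

(** Minimality at [s = 0] gives 0 <= s I + e |s| V, where I is the integral of [G] and V the volume;
    taking both signs of [s] yields |I| <= e V for every positive [e]. *)
Lemma jet_integral_eq0 m (tau : 'rV[R]_m) (F : R -> 'rV[R]_m -> R) f G :
  (forall a, 0 < tau 0 a) -> jet (box tau) F f G ->
  {within box tau, continuous f} -> {within box tau, continuous G} ->
  (\forall s \near (0 : R), {within box tau, continuous (F s)} /\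
     box_integral tau f <= box_integral tau (F s)) ->
  box_integral tau G = 0.
Proof.
move=> tau0 [_ J] cf cG HF.
set V := box_integral tau (fun=> 1).
have c1 : {within box tau, continuous (fun=> 1 : R)} by move=> t; exact: cvg_cst.
have V0 : 0 <= V by exact: box_integral1_ge0 (@box_integralP _ m) tau0.
have key e : 0 < e -> `|box_integral tau G| <= e * V.
  move=> e0; have := J e e0 => /(filterI HF) /nbhs_ballP[r /= r0 H].
  have step s : `|s| < r -> 0 <= s * box_integral tau G + e * `|s| * V.
    move=> sr; have [[cFs le1] H2] : _ := H s (ltac:(by rewrite /ball /= sub0r normrN)).
    have csG : {within box tau, continuous (fun t => s * G t + f t)}.
      by move=> t; apply: cvgD (cf t); apply: cvgM (cG t); exact: cvg_cst.
    have cup : {within box tau, continuous (fun t => e * `|s| * 1 + (s * G t + f t))}.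
      by move=> t; apply: cvgD (csG t); exact: cvg_cst.
    have : box_integral tau (F s) <=
        box_integral tau (fun t => e * `|s| * 1 + (s * G t + f t)).
      apply: le_box_integral => // t Bt.
      by have := H2 t Bt; rewrite ler_norml => /andP[_]; lra.
    rewrite box_integralZD// box_integralZD// -/V; lra.
  have r2 : 0 < r / 2 by rewrite divr_gt0.
  have := step (r / 2); have := step (- (r / 2)).
  rewrite normrN gtr0_norm// ltr_pdivrMr// ltr_pMr// ltr1n => /(_ isT) h1 /(_ isT) h2.
  rewrite ler_norml; apply/andP; split.
    rewrite -(ler_pM2l r2); lra.
  rewrite -(ler_pM2l r2); lra.
apply/eqP; rewrite -normr_le0; apply/ler_addgt0Pr => e e0; rewrite add0r.
have V1 : 0 < V + 1 by rewrite ltr_wpDl.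
apply: le_trans (key (e / (V + 1)) _) _; first by rewrite divr_gt0.
by rewrite mulrAC ler_pdivrMr// ler_wpM2l ?ltW// ltrDl.
Qed.

End FirstVariation.

(** * Regularity of the inverse of a matrix field *)

Section MatrixFields.
Set Implicit Arguments.
Unset Strict Implicit.
Context {R : realType}.

Lemma posdef_unitmx n (A : 'M[R]_n) :
  (forall v : 'rV[R]_n, v != 0 -> 0 < (v *m A *m v^T) 0 0) -> A \in unitmx.
Proof.
move=> pA; rewrite -row_free_unit -kermx_eq0; apply/negPn/negP => /rowV0Pn[v].
by move=> /sub_kermxP vA /pA; rewrite vA mul0mx mxE ltxx.
Qed.

Lemma class_C1_det m (tau : 'rV[R]_m) p (A : 'rV[R]_m -> 'M[R]_p) :
  (forall a, 0 < tau 0 a) -> (forall i j, class_C 1 (box tau) (fun t => A t i j)) ->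
  class_C 1 (box tau) (fun t => \det (A t)).
Proof.
move=> tau0 CA; apply: class_C1_sum => // s _; apply: class_C1M => //.
  exact: class_C1_cst.
by apply: class_C1_prod.
Qed.

(** Cramer's rule: the entries are cofactors over the determinant. The formula is that of [invmx]
    only where the matrix is invertible, so equality is invoked on the box alone. *)
Lemma class_C1_invmx m (tau : 'rV[R]_m) p (A : 'rV[R]_m -> 'M[R]_p) i j :
  (forall a, 0 < tau 0 a) -> (forall i j, class_C 1 (box tau) (fun t => A t i j)) ->
  (forall t, box tau t -> A t \in unitmx) ->
  class_C 1 (box tau) (fun t => invmx (A t) i j).
Proof.
move=> tau0 CA uA.
apply: (@eq_class_C1 _ _ tau tau0 (fun t => (\det (A t))^-1 *
    ((-1) ^+ (j + i) * \det (row' j (col' i (A t)))))).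
  by move=> t Bt; rewrite /invmx uA// !mxE.
apply: class_C1M => //.
  apply: class_C1V => //; last exact: class_C1_det.
  by move=> t Bt; rewrite -unitfE -unitmxE uA.
apply: class_C1M => //; first exact: class_C1_cst.
apply: class_C1_det => // i' j'.
by under [X in class_C _ _ X]funext do rewrite !mxE; exact: CA.
Qed.

End MatrixFields.

(** * The bilinear form behind the energy density *)

Section BilinearForm.
Set Implicit Arguments.
Unset Strict Implicit.
Context {R : realType} {m n : nat}.
Context (h : 'rV[R]_m -> 'M[R]_m) (g : 'rV[R]_n -> 'M[R]_n).
Implicit Types (v w : 'M[R]_(m, n)).

(** Polar form of [hg_form], to which it is convertible when both arguments agree. The arguments are
    varied separately, so both orders occur in [momentum]. *)
Definition hg_bil t y v w : R :=
  \sum_(a < m) \sum_(b < m) \sum_(i < n) \sum_(j < n)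
    invmx (h t) a b * g y i j * v a i * w b j.

Lemma hg_bil_linl t y c v v' w :
  hg_bil t y (c *: v + v') w = c * hg_bil t y v w + hg_bil t y v' w.
Proof.
rewrite /hg_bil mulr_sumr -big_split; apply: eq_bigr => a _.
rewrite mulr_sumr -big_split; apply: eq_bigr => b _.
rewrite mulr_sumr -big_split; apply: eq_bigr => i _.
rewrite mulr_sumr -big_split; apply: eq_bigr => j _ /=.
by rewrite !mxE; ring.
Qed.

Lemma hg_bil_linr t y c v w w' :
  hg_bil t y v (c *: w + w') = c * hg_bil t y v w + hg_bil t y v w'.
Proof.
rewrite /hg_bil mulr_sumr -big_split; apply: eq_bigr => a _.
rewrite mulr_sumr -big_split; apply: eq_bigr => b _.
rewrite mulr_sumr -big_split; apply: eq_bigr => i _.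
rewrite mulr_sumr -big_split; apply: eq_bigr => j _ /=.
by rewrite !mxE; ring.
Qed.

Lemma hg_bil0l t y w : hg_bil t y 0 w = 0.
Proof.
have := hg_bil_linl t y 1 0 0 w; rewrite scaler0 addr0 mul1r => /eqP.
by rewrite -[X in X == _]addr0 (inj_eq (addrI _)) => /eqP.
Qed.

Lemma hg_bil0r t y v : hg_bil t y v 0 = 0.
Proof.
have := hg_bil_linr t y 1 v 0 0; rewrite scaler0 addr0 mul1r => /eqP.
by rewrite -[X in X == _]addr0 (inj_eq (addrI _)) => /eqP.
Qed.

Lemma hg_bil_suml t y p (c : 'I_p -> R) (v : 'I_p -> 'M[R]_(m, n)) w :
  hg_bil t y (\sum_i c i *: v i) w = \sum_i c i * hg_bil t y (v i) w.
Proof.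
elim: p c v => [|p IH] c v; first by rewrite !big_ord0 hg_bil0l.
by rewrite !big_ord_recl hg_bil_linl IH.
Qed.

Lemma hg_bil_sumr t y p (c : 'I_p -> R) v (w : 'I_p -> 'M[R]_(m, n)) :
  hg_bil t y v (\sum_i c i *: w i) = \sum_i c i * hg_bil t y v (w i).
Proof.
elim: p c w => [|p IH] c w; first by rewrite !big_ord0 hg_bil0r.
by rewrite !big_ord_recl hg_bil_linr IH.
Qed.

Section OnBox.
Context (M : set 'rV[R]_n) (tau : 'rV[R]_m).
Context (oM : open M) (gM : riemannian_metric M g)
  (hO : riemannian_metric orthant h) (tau0 : forall a, 0 < tau 0 a).
Local Notation B := (box tau).

Lemma class_C1_hinv a b : class_C 1 B (fun t => invmx (h t) a b).
Proof.
have BO : B `<=` @orthant R m by move=> t Bt a'; have /andP[] := Bt a'.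
have [hC _ hp] := hO; apply: class_C1_invmx => //.
  by move=> i j; apply: class_C1_restrict (hC 1%N i j).
by move=> t Bt; apply: posdef_unitmx; apply: hp; exact: BO.
Qed.

Lemma class_C1_hg_bil (y : 'rV[R]_m -> 'rV[R]_n) (V W : 'rV[R]_m -> 'M[R]_(m, n)) :
  (forall t, B t -> M (y t)) ->
  (forall i, class_C 1 B (fun t => y t 0 i)) ->
  (forall a i, class_C 1 B (fun t => V t a i)) ->
  (forall a i, class_C 1 B (fun t => W t a i)) ->
  class_C 1 B (fun t => hg_bil t (y t) (V t) (W t)).
Proof.
move=> My Cy CV CW; have [gC _ _] := gM.
do 2!(apply: class_C1_sum => // ? _).
apply: class_C1_sum => // i _; apply: class_C1_sum => // j _.
do 3!apply: class_C1M => //; first exact: class_C1_hinv.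
exact: (class_C1_comp tau0 oM (gC 2%N i j) My Cy).
Qed.

End OnBox.
End BilinearForm.

(** * The first variation of the energy *)

Section Variation.
Set Implicit Arguments.
Unset Strict Implicit.
Context {R : realType} {m n : nat}.
Context (M : set 'rV[R]_n) (g : 'rV[R]_n -> 'M[R]_n) (h : 'rV[R]_m -> 'M[R]_m)
  (tau : 'rV[R]_m).
Context (oM : open M) (gM : riemannian_metric M g)
  (hO : riemannian_metric orthant h) (tau0 : forall a, 0 < tau 0 a).
Local Notation B := (box tau).
Context (x : 'rV[R]_m -> 'rV[R]_n) (u : 'rV[R]_m -> 'M[R]_(m, n)).
Context (xM : forall t, B t -> M (x t))
  (xC : forall i, class_C 1 B (fun t => x t 0 i))
  (uC : forall a i, class_C 1 B (fun t => u t a i)).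

Definition force (k : 'I_n) t : R :=
  \sum_(a < m) \sum_(b < m) \sum_(i < n) \sum_(j < n)
    invmx (h t) a b * pderiv M k (fun y => g y i j) (x t) * u t a i * u t b j.

(** Derivative of the quadratic form [hg_form] in the velocity entry [(a, k)]: the conjugate
    momentum up to the factor -1/2, just as [force] is the derivative in the position. *)
Definition momentum (a : 'I_m) (k : 'I_n) t : R :=
  hg_bil h g t (x t) (u t) (delta_mx a k) + hg_bil h g t (x t) (delta_mx a k) (u t).

(* [-2] times the left-hand side of the Euler-Lagrange equation, see
   [dL_dx_lagrangian] and [dL_dv_lagrangian]. *)
Definition el_defect (k : 'I_n) t : R :=
  force k t - \sum_(a < m) pderiv B a (momentum a k) t.

Lemma class_C1_force k : class_C 1 B (force k).
Proof.
have [gC _ _] := gM.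
do 2!(apply: class_C1_sum => // ? _).
apply: class_C1_sum => // i _; apply: class_C1_sum => // j _.
do 3!apply: class_C1M => //; first exact: class_C1_hinv hO tau0 _ _.
(* Class C^3 of [g] makes its partial derivative C^2, as [class_C1_comp] asks. *)
have [_ /(_ k)[_ dgC]] := gC 3%N i j.
exact: (class_C1_comp tau0 oM dgC xM xC).
Qed.

Lemma class_C1_momentum a k : class_C 1 B (momentum a k).
Proof.
have dC a' i : class_C 1 B (fun=> (delta_mx a k : 'M[R]_(m, n)) a' i) by exact: class_C1_cst.
by apply: class_C1D => //; apply: (class_C1_hg_bil oM gM hO).
Qed.

Lemma el_defect_continuous k : {within B, continuous (el_defect k)}.
Proof.
have [cF _] := class_C1_force k.
move=> t; apply: cvgB; first exact: cF.
apply: cvg_big => [|a _]; first exact: add_continuous.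
exact: (class_C1_box_pderiv (class_C1_momentum a k)).
Qed.

(** Each summand is a product of four expansions. The lemma serves three times: with the bump and
    its gradient for the energy, with [eta = 1] and [V = 0] for [dL_dx], and with [eta = 0] and an
    elementary matrix for [dL_dv]. *)
Lemma jet_hg_form k (eta : 'rV[R]_m -> R) (V : 'rV[R]_m -> 'M[R]_(m, n)) :
  {within B, continuous eta} ->
  (forall a i, {within B, continuous (fun t => V t a i)}) ->
  jet B (fun s t => hg_form h g t (x t + (s * eta t) *: basis_vec k) (u t + s *: V t))
    (fun t => hg_form h g t (x t) (u t))
    (fun t => eta t * force k t +
       (hg_bil h g t (x t) (u t) (V t) + hg_bil h g t (x t) (V t) (u t))).
Proof.
move=> ceta cV; have [gC _ _] := gM.
have cx i : {within B, continuous (fun t => x t 0 i)} by have [] := xC i.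
pose dterm a b i j t := invmx (h t) a b *
  (eta t * pderiv M k (fun y => g y i j) (x t) * (u t a i * u t b j)
   + g (x t) i j * (V t a i * u t b j + u t a i * V t b j)).
have jterm a b i j : jet B
    (fun s t => invmx (h t) a b * g (x t + (s * eta t) *: basis_vec k) i j *
       (u t + s *: V t) a i * (u t + s *: V t) b j)
    (fun t => invmx (h t) a b * g (x t) i j * u t a i * u t b j) (dterm a b i j).
  have [ch _] := class_C1_hinv hO tau0 a b.
  have [C HC] := box_bounded ch.
  have jg := jet_shift k cx ceta oM (gC 1%N i j) xM.
  have ju a' i' : jet B (fun s t => (u t + s *: V t) a' i') (fun t => u t a' i')
      (fun t => V t a' i').
    have [cu _] := uC a' i'.
    have [C1 B1] := box_bounded cu; have [C2 B2] := box_bounded (cV a' i').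
    rewrite (_ : (fun s t => _) = fun s t => u t a' i' + s * V t a' i'); last first.
      by apply/funext => s; apply/funext => t; rewrite !mxE.
    apply: (@jet_affine _ _ _ _ _ (`|C1| + `|C2|)) => t Bt; split.
      by rewrite (le_trans (B1 t Bt))// (le_trans (ler_norm _))// lerDl.
    by rewrite (le_trans (B2 t Bt))// (le_trans (ler_norm _))// lerDr.
  have := jetM (jetM (jetM (jet_cst HC) jg) (ju a i)) (ju b j).
  set G := (X in jet _ _ _ X); rewrite (_ : G = dterm a b i j)//.
  by apply/funext => t; rewrite /G /dterm /=; ring.
have := jet_sum (fun a => jet_sum (fun b => jet_sum (fun i => jet_sum (fun j => jterm a b i j)))).
set G := (X in jet _ _ _ X); rewrite (_ : G = fun t => eta t * force k t +
       (hg_bil h g t (x t) (u t) (V t) + hg_bil h g t (x t) (V t) (u t)))//.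
apply/funext => t; rewrite /G /force /hg_bil mulr_sumr -!big_split; apply: eq_bigr => a _ /=.
rewrite mulr_sumr -!big_split; apply: eq_bigr => b _ /=.
rewrite mulr_sumr -!big_split; apply: eq_bigr => i _ /=.
rewrite mulr_sumr -!big_split; apply: eq_bigr => j _ /=.
by rewrite /dterm; ring.
Qed.

Lemma dL_dx_lagrangian k t : B t ->
  dL_dx (lagrangian h g) k t (x t) (u t) = - (1 / 2) * force k t.
Proof.
move=> Bt.
have c1 : {within B, continuous (fun=> 1 : R)} by move=> s; exact: cvg_cst.
have c0 a i : {within B, continuous (fun=> (0 : 'M[R]_(m, n)) a i)} by move=> s; exact: cvg_cst.
have J := jet_hg_form k c1 c0.
have := jet_derive1 (- (1 / 2)) J Bt.
rewrite mul0r scale0r addr0 scaler0 addr0 => /(_ erefl).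
rewrite hg_bil0l hg_bil0r !addr0 [1 * force k t]mul1r => <-; rewrite /dL_dx.
rewrite (_ : (fun s => lagrangian _ _ _ _ _) = fun s : R => - (1 / 2) *
    hg_form h g t (x t + (s * 1) *: basis_vec k) (u t + s *: 0))//.
by apply/funext => s; rewrite scaler0 addr0 mulr1.
Qed.

Lemma dL_dv_lagrangian a k t : B t ->
  dL_dv (lagrangian h g) a k t (x t) (u t) = - (1 / 2) * momentum a k t.
Proof.
move=> Bt.
have c0 : {within B, continuous (fun=> 0 : R)} by move=> s; exact: cvg_cst.
have cd a' i : {within B, continuous (fun=> (delta_mx a k : 'M[R]_(m, n)) a' i)}.
  by move=> s; exact: cvg_cst.
have J := jet_hg_form k c0 cd.
have := jet_derive1 (- (1 / 2)) J Bt.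
rewrite mul0r scale0r addr0 scale0r addr0 => /(_ erefl).
rewrite mul0r add0r => <-; rewrite /dL_dv.
rewrite (_ : (fun s => lagrangian _ _ _ _ _) = fun s : R => - (1 / 2) *
    hg_form h g t (x t + (s * 0) *: basis_vec k) (u t + s *: delta_mx a k))//.
by apply/funext => s; rewrite mulr0 scale0r addr0.
Qed.

(** * Varying the sheet by a bump in one coordinate *)

Section BumpVariation.
Context (c : 'rV[R]_m) (rho : R) (k : 'I_n).
Context (support : forall t, 0 < paraboloid c rho t -> forall a, 0 < t 0 a < tau 0 a).
Local Notation eta := (bump c rho).

Definition bump_velocity t : 'M[R]_(m, n) :=
  \matrix_(a, i) (dbump c rho a t * (i == k)%:R).

Definition varied_sheet (s : R) t := x t + (s * eta t) *: basis_vec k.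

Definition varied_control (s : R) t := u t + s *: bump_velocity t.

(** In this form, linearity of [hg_bil] in each argument produces the momenta. *)
Lemma bump_velocityE t :
  bump_velocity t = \sum_a dbump c rho a t *: delta_mx a k.
Proof.
apply/matrixP => a i; rewrite mxE summxE (bigD1 a)//= big1 => [|b ba].
  by rewrite !mxE eqxx addr0.
by rewrite !mxE eq_sym (negbTE ba) mulr0.
Qed.

Lemma class_C1_varied_sheet s i : class_C 1 B (fun t => varied_sheet s t 0 i).
Proof.
under [X in class_C _ _ X]funext do rewrite line_coord.
apply: class_C1D => //; apply: class_C1M => //; last exact: class_C1_cst.
by apply: class_C1M => //; [exact: class_C1_cst|exact: class_C1_bump].
Qed.

Lemma class_C1_varied_control s a i : class_C 1 B (fun t => varied_control s t a i).
Proof.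
under [X in class_C _ _ X]funext do rewrite !mxE.
apply: class_C1D => //; apply: class_C1M => //; first exact: class_C1_cst.
by apply: class_C1M => //; [exact: class_C1_dbump|exact: class_C1_cst].
Qed.

Lemma paraboloid_boundary t : box_boundary tau t -> paraboloid c rho t <= 0.
Proof.
move=> [Bt [a ta]]; rewrite leNgt; apply/negP => /support/(_ a)/andP[].
by case: ta => ->; rewrite ltxx.
Qed.

Lemma is_pder_sheet t a i : sheet_of M tau u x -> B t ->
  is_pder B a (fun s => x s 0 i) t (u t a i).
Proof. by move=> xu Bt; have [_ /(_ a i)[+ <-]] := xu t Bt; exact. Qed.

Lemma varied_sheet_of s : sheet_of M tau u x ->
  (forall t, B t -> M (varied_sheet s t)) ->
  sheet_of M tau (varied_control s) (varied_sheet s).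
Proof.
move=> xu yM t Bt; split=> [|a i]; first exact: yM.
have H : is_pder B a (fun r => varied_sheet s r 0 i) t (varied_control s t a i).
  under [X in is_pder _ _ X]funext do rewrite line_coord.
  apply: is_pder_eq.
    apply: is_pderD; first exact: is_pder_sheet.
    apply: is_pderM; last exact: is_pder_cst.
    by apply: is_pderM; [exact: is_pder_cst|exact: is_pder_bump].
  by rewrite !mxE /=; ring.
by split; [apply/cvg_ex; eexists; exact: H|exact: pderiv_box_eq].
Qed.

Lemma varied_control_set s : control_set tau u ->
  (forall t, B t -> row_free (varied_control s t)) ->
  control_set tau (varied_control s).
Proof.
move=> [_ _ uI] wF; split=> //; first exact: class_C1_varied_control.
move=> t Bt a b i.
have dE a' b' : pderiv B b' (fun r => varied_control s r a' i) t =
    pderiv B b' (fun r => u r a' i) t +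
    s * (pderiv B b' (dbump c rho a') t * (i == k)%:R).
  apply: pderiv_box_eq => //.
  under [X in is_pder _ _ X]funext do rewrite !mxE.
  apply: is_pder_eq.
    apply: is_pderD; first exact: class_C1_box_pder.
    apply: is_pderM; first exact: is_pder_cst.
    apply: is_pderM; last exact: is_pder_cst.
    by apply: class_C1_box_pder => //; exact: class_C1_dbump.
  by rewrite /=; ring.
by rewrite !dE uI// pderiv_dbumpC.
Qed.

(** The gradient of the bump vanishes on the boundary along with the bump, so prescribed boundary
    controls survive as well as the end points. *)
Lemma varied_admissible x0 x1 ub s : (0 < m)%N ->
  admissible M tau x0 x1 ub x u ->
  (forall t, B t -> M (varied_sheet s t)) ->
  (forall t, B t -> row_free (varied_control s t)) ->
  admissible M tau x0 x1 ub (varied_sheet s) (varied_control s).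
Proof.
move=> m0 [uU xu xx0 xx1 xub] yM wF.
have fixed t : box_boundary tau t -> varied_sheet s t = x t.
  by move=> /paraboloid_boundary q0; rewrite /varied_sheet bump_le0// mulr0 scale0r addr0.
(* A coordinate must exist for the corners 0 and [tau] to count as boundary points, where [fixed]
   applies. *)
have a0 := Ordinal m0.
split.
- exact: varied_control_set.
- exact: varied_sheet_of.
- rewrite fixed//; split; last by exists a0; left; rewrite mxE.
  by move=> a; rewrite mxE lexx ltW.
- rewrite fixed//; split; last by exists a0; right.
  by move=> a; rewrite lexx ltW.
- case: ub xub => // w uw t tb; rewrite -uw// /varied_control.
  rewrite (_ : bump_velocity t = 0) ?scaler0 ?addr0//.
  by apply/matrixP => a i; rewrite !mxE dbump_le0 ?mul0r//; exact: paraboloid_boundary.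
Qed.

(** The energy is -1/2 times the integral of [hg_form], so a maximiser of the energy minimises that
    integral, and [jet_integral_eq0] applies. *)
Lemma first_variation x0 x1 ub : (0 < m)%N -> optimal M h g tau x0 x1 ub x u ->
  box_integral tau (fun t => eta t * force k t +
    \sum_a dbump c rho a t * momentum a k t) = 0.
Proof.
move=> m0 [xadm xopt].
have [_ uF _] : control_set tau u by case: xadm.
have cx i : {within B, continuous (fun t => x t 0 i)} by have [] := xC i.
have cu a i : {within B, continuous (fun t => u t a i)} by have [] := uC a i.
have [ceta _] : class_C 1 B eta by exact: class_C1_bump.
have cV a i : {within B, continuous (fun t => bump_velocity t a i)}.
  rewrite (_ : (fun t => _) = fun t => dbump c rho a t * (i == k)%:R); last first.
    by apply/funext => t; rewrite mxE.
  have [cd _] := class_C1_dbump tau0 c rho a.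
  by move=> t; apply: cvgM (cd t) _; exact: cvg_cst.
have J := jet_hg_form k ceta cV.
move: J; set G := (X in jet _ _ _ X).
have -> : G = fun t => eta t * force k t + \sum_a dbump c rho a t * momentum a k t.
  apply/funext => t; rewrite /G bump_velocityE hg_bil_sumr hg_bil_suml -big_split /=.
  by congr (_ + _); apply: eq_bigr => a _; rewrite -mulrDr.
move=> J; apply: (jet_integral_eq0 tau0 J).
- by have [] := class_C1_hg_bil oM gM hO tau0 xM xC uC uC.
- have [cF _] := class_C1_force k.
  move=> t; apply: cvgD; first exact: cvgM (ceta t) (cF t).
  apply: cvg_big => [|a _]; first exact: add_continuous.
  have [cd _] := class_C1_dbump tau0 c rho a; have [cp _] := class_C1_momentum a k.
  exact: cvgM (cd t) (cp t).
have nM : \forall s \near (0 : R), forall t, B t -> M (varied_sheet s t).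
  apply: (near_shift_all k cx ceta) => t Bt.
  by apply: open_nbhs_nbhs; split => //; exact: xM.
move: nM (near_row_free cu cV uF); apply: filterS2 => s yM wF.
split.
  have := class_C1_hg_bil oM gM hO tau0 yM (class_C1_varied_sheet s)
    (class_C1_varied_control s) (class_C1_varied_control s).
  by case.
have := xopt _ _ (varied_admissible m0 xadm yM wF).
rewrite /energy -/(varied_sheet s) -/(varied_control s); lra.
Qed.

Lemma weak_euler_lagrange x0 x1 ub : (0 < m)%N -> optimal M h g tau x0 x1 ub x u ->
  box_integral tau (fun t => eta t * el_defect k t) = 0.
Proof.
move=> m0 xopt; have V0 := first_variation m0 xopt.
have Ceta : class_C 1 B eta by exact: class_C1_bump.
have [ceta _] := Ceta.
have [cF _] := class_C1_force k.
have cp a : {within B, continuous (momentum a k)} by have [] := class_C1_momentum a k.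
have cdp a : {within B, continuous (pderiv B a (momentum a k))}.
  exact: class_C1_box_pderiv (class_C1_momentum a k).
have cd a : {within B, continuous (dbump c rho a)} by have [] := class_C1_dbump tau0 c rho a.
(* [D a] is the partial derivative of [bump] times [momentum a k], so its integral is 0. Adding all
   of them to the bump times [el_defect] gives the integrand of the first variation. *)
pose D a t := dbump c rho a t * momentum a k t + eta t * pderiv B a (momentum a k) t.
have cD a : {within B, continuous (D a)}.
  by move=> t; exact: cvgD (cvgM (cd a t) (cp a t)) (cvgM (ceta t) (cdp a t)).
have ID a : box_integral tau (D a) = 0.
  apply: (@box_integral_pder0 _ _ tau a (fun t => eta t * momentum a k t)) => //.
  - by move=> t; exact: cvgM (ceta t) (cp a t).
  - move=> t Bt; apply: is_pderM; first exact: is_pder_bump.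
    by apply: class_C1_box_pder => //; exact: class_C1_momentum.
  - move=> t Bt ta; rewrite bump_le0 ?mul0r//; apply: paraboloid_boundary.
    by split => //; exists a.
have cW : {within B, continuous (fun t => eta t * el_defect k t)}.
  by move=> t; exact: cvgM (ceta t) (@el_defect_continuous k t).
have csD : {within B, continuous (fun t => \sum_a D a t)}.
  by move=> t; apply: cvg_big => [|a _]; [exact: add_continuous|exact: cD].
have := box_integralD tau0 cW csD.
rewrite box_integral_sum// [X in _ = _ + X]big1 => [|a _]; last exact: ID.
rewrite addr0 => <-; rewrite -[RHS]V0; congr box_integral; apply/funext => t.
have E : eta t * \sum_a pderiv B a (momentum a k) t =
    \sum_a eta t * pderiv B a (momentum a k) t by rewrite mulr_sumr.
rewrite /el_defect /D big_split /= mulrBr E.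
by rewrite -addrA [X in _ + X]addrCA addNr addr0.
Qed.

End BumpVariation.

Lemma el_defect_interior x0 x1 ub k (c : 'rV[R]_m) : optimal M h g tau x0 x1 ub x u ->
  (forall a, 0 < c 0 a < tau 0 a) -> el_defect k c = 0.
Proof.
move=> xopt cI; have [m0|m0] := posnP m.
  (* Here the box is a single point, fixed by the boundary conditions, so that
     there is nothing to vary; but all the sums are empty. *)
  have no a : 'I_m -> a by case=> i; rewrite m0.
  by rewrite /el_defect /force !big1 ?subr0// => a; exact: no.
have Bc : B c by move=> a; have /andP[? ?] := cI a; rewrite !ltW.
pose W := el_defect k; have cW : {within B, continuous W} := @el_defect_continuous k.
apply/eqP/negPn/negP => Wc; have sc : 0 < `|W c| by rewrite normr_gt0.
(* One ball serves two purposes: it lies in the interior, which gives the support condition, and the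
   defect keeps its sign there. *)
have : \forall t \near c, (forall a, 0 < (t : 'rV[R]_m) 0 a < tau 0 a) /\ (B t -> `|W c - W t| < `|W c|).
  near=> t; split; near: t.
    apply: filter_forall => a.
    have [c1 c2] : 0 < c 0 a /\ c 0 a < tau 0 a by apply/andP.
    have cc := @coord_continuous R 1 m 0 a c.
    near=> t; apply/andP; split; near: t.
      by apply: (cvgr_gt _ cc).
    by apply: (cvgr_lt _ cc).
  by move/subspace_continuousP : cW => /(_ _ Bc)/cvgrPdist_lt/(_ _ sc).
move=> /nbhs_ballP[rho /= rho0 H].
have supp t : 0 < paraboloid c rho t -> forall a, 0 < t 0 a < tau 0 a.
  by move=> /(paraboloid_gt0 rho0)/H[].
have W0 := weak_euler_lagrange k supp m0 xopt.
(* Multiplying by the sign makes the integrand nonnegative in both cases, and positive at [c]. *)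
pose sg := Num.sg (W c).
have [ceta _] : class_C 1 B (bump c rho) by exact: class_C1_bump.
have cI1 : {within B, continuous (fun t => bump c rho t * W t)}.
  by move=> t; exact: cvgM (ceta t) (cW t).
have : 0 < box_integral tau (fun t => sg * (bump c rho t * W t)).
  apply: (@box_integral_gt0 _ _ tau _ c) => //.
  - by move=> t; apply: cvgM (cI1 t); exact: cvg_cst.
  - move=> t Bt; have [q0|q0] := ltP 0 (paraboloid c rho t); last first.
      by rewrite bump_le0// mul0r mulr0.
    have [_ /(_ Bt) WW] := H _ (paraboloid_gt0 rho0 q0).
    rewrite mulrCA mulr_ge0//; first by rewrite ltW// bump_gt0.
    rewrite /sg; have [_|Wp|Wn] := sgrP (W c); first by rewrite mul0r.
      by move: WW; rewrite mul1r (gtr0_norm Wp) ltr_norml => /andP[]; lra.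
    by move: WW; rewrite mulN1r (ltr0_norm Wn) ltr_norml => /andP[]; lra.
  - rewrite mulrCA mulr_gt0//; first by apply: bump_gt0; exact: paraboloid_center.
    by rewrite -normrEsg.
by rewrite box_integralZ// W0 mulr0 ltxx.
Unshelve. all: by end_near. Qed.

(** The segment from [t] to the centre of the box enters the interior at once; the defect is 0
    there, and continuity carries this to [t]. *)
Lemma el_defect_eq0 x0 x1 ub k t : optimal M h g tau x0 x1 ub x u -> B t ->
  el_defect k t = 0.
Proof.
move=> xopt Bt; pose W := el_defect k.
apply/eqP/negPn/negP => Wt; have st : 0 < `|W t| by rewrite normr_gt0.
have /subspace_continuousP/(_ _ Bt)/cvgrPdist_lt/(_ _ st) := @el_defect_continuous k.
rewrite near_withinE => H.
have path : t + s *: (2^-1 *: tau - t) @[s --> (0 : R)] --> t.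
  apply: cvg_mx => i a; rewrite ord1.
  rewrite (_ : (fun s => _) = fun s => t 0 a + s * (2^-1 * tau 0 a - t 0 a)); last first.
    by apply/funext => s; rewrite !mxE.
  have : t 0 a + s * (2^-1 * tau 0 a - t 0 a) @[s --> (0 : R)] -->
      t 0 a + 0 * (2^-1 * tau 0 a - t 0 a).
    by apply: cvgD; [exact: cvg_cst|apply: cvgM; [exact: cvg_id|exact: cvg_cst]].
  by rewrite mul0r addr0.
have /nbhs_ballP[r /= r0 Hr] : \forall s \near (0 : R),
  B (t + s *: (2^-1 *: tau - t)) -> `|W t - W (t + s *: (2^-1 *: tau - t))| < `|W t|
  := path _ H.
(* For 0 < s <= 1/2 the coordinate (1 - s) t_a + (s / 2) tau_a is strictly between 0 and tau_a. *)
pose s := Num.min (r / 2) (1 / 2).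
have s0 : 0 < s by rewrite lt_min !divr_gt0.
have sr : s < r by rewrite (@le_lt_trans _ _ (r / 2)) ?ge_min ?lexx// ltr_pdivrMr// ltr_pMr// ltr1n.
have s1 : s <= 1 / 2 by rewrite ge_min lexx orbT.
have inter a : 0 < (t + s *: (2^-1 *: tau - t)) 0 a < tau 0 a.
  have /andP[ta0 tat] := Bt a; have taua := tau0 a.
  by rewrite !mxE; apply/andP; split; nra.
have Bs : B (t + s *: (2^-1 *: tau - t)).
  by move=> a; have /andP[? ?] := inter a; rewrite !ltW.
have := Hr s; rewrite /ball /= sub0r normrN gtr0_norm// => /(_ sr Bs).
by rewrite /W (el_defect_interior k xopt inter) subr0 ltxx.
Qed.

End Variation.

Theorem theorem6p2 (R : realType) (m n : nat)
    (M : set 'rV[R]_n) (g : 'rV[R]_n -> 'M[R]_n) (h : 'rV[R]_m -> 'M[R]_m)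
    (tau : 'rV[R]_m) (x0 x1 : 'rV[R]_n)
    (ub : option ('rV[R]_m -> 'M[R]_(m, n)))
    (x : 'rV[R]_m -> 'rV[R]_n) (u : 'rV[R]_m -> 'M[R]_(m, n)) :
  open M -> riemannian_metric M g ->
  riemannian_metric orthant h ->
  (forall a, 0 < tau 0 a) ->
  optimal M h g tau x0 x1 ub x u ->
  class_C2_sheet tau x ->
  harmonic_map M h g tau x.
Proof.
move=> oM gM hO tau0 xopt xC2.
have [[uC _ _] xu _ _ _] : admissible M tau x0 x1 ub x u by case: xopt.
have xM t : box tau t -> M (x t) by move=> /xu[].
have xC i : class_C 1 (box tau) (fun t => x t 0 i).
  by have [cx Hx] := xC2 i; split => // a; have [? []] := Hx a.
have vE t : box tau t -> velocity tau x t = u t.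
  by move=> Bt; apply/matrixP => a i; rewrite mxE; have [_ /(_ a i)[]] := xu t Bt.
split=> // t Bt k.
rewrite vE// (dL_dx_lagrangian oM gM hO tau0 xM xC uC)//.
(* The total derivative only sees values on the box, where the velocity is [u] and [dL_dv] is -1/2
   times the momentum. *)
have tdE a : total_deriv tau x a (dL_dv (lagrangian h g) a k) t =
    - (1 / 2) * pderiv (box tau) a (momentum g h x u a k) t.
  apply: pderiv_box_eq => //.
  apply: (@eq_is_pder _ _ _ _ (fun s => - (1 / 2) * momentum g h x u a k s)) => //.
    by move=> s Bs; rewrite vE// (dL_dv_lagrangian oM gM hO tau0 xM xC uC).
  apply: is_pder_eq.
    apply: is_pderM; first exact: is_pder_cst.
    by apply: class_C1_box_pder => //; exact: (class_C1_momentum oM gM hO tau0 xM xC uC).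
  by rewrite /= mul0r add0r.
under eq_bigr do rewrite tdE.
rewrite -mulr_sumr -mulrBr.
have := el_defect_eq0 oM gM hO tau0 xM xC uC k xopt Bt.
by rewrite /el_defect => ->; rewrite mulr0.
Qed.
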